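(* Let $\Lambda$ be a uniformly discrete approximate subring of a locally compact ring $A$. Then $\Lambda$ is commensurable with a weak model set associated with the direct space $A$ and an internal space $B$ which is a finite-dimensional real algebra.
   Context: Rings and algebras are associative, not necessarily commutative or unital; locally compact spaces are Hausdorff by definition. Finite-dimensional real algebras carry their usual topology. A subset $X$ of a ring is an approximate subring if it is additively symmetric ($0\in X$, $X=-X$) and $(X\cdot X)\cup(X+X)$ is covered by finitely many additive translates of $X$. A subset $X$ of a locally compact ring is uniformly discrete if there is a neighbourhood $W$ of $0$ such that $(x+W)\cap(y+W)=\emptyset$ for all distinct $x,y\in X$. Two subsets are commensurable if each is covered by finitely many additive translates of the other. A cut-and-project scheme is a triple $(A,B,\Delta)$ of locally compact rings $A$ (the direct space), $B$ (the internal space) and a discrete subring $\Delta\subseteq A\times B$ projecting injectively to $A$. Given a relatively compact additively symmetric neighbourhood $W_0\subseteq B$ of $0$, the set $M:=\pi_A[\Delta\cap(A\times W_0)]$, where $\pi_A\colon A\times B\to A$ is the natural projection, is called a weak model set (associated with direct space $A$ and internal space $B$). *)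

(* Defs.v *)
From HB Require Import structures.
From mathcomp Require Import all_boot all_order all_algebra.
From mathcomp Require Import all_classical all_reals all_analysis.

Set Implicit Arguments.
Unset Strict Implicit.
Unset Printing Implicit Defensive.

Import Order.TTheory GRing.Theory Num.Theory.
Import numFieldNormedType.Exports.

Local Open Scope classical_set_scope.
Local Open Scope ring_scope.

(* The ring structures of MathComp are all unital. A possibly non-unital ring
   is therefore given by its additive group (a zmodType) together with an
   explicit multiplication [mul]. *)

Definition ring_mult (A : zmodType) (mul : A -> A -> A) : Prop :=
  [/\ associative mul, left_distributive mul +%R & right_distributive mul +%R].

(* Continuity of addition and opposite is part of topologicalZmodType. *)
Definition locally_compact_ring (A : topologicalZmodType) (mul : A -> A -> A) :
    Prop :=
  [/\ ring_mult mul,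
      continuous (fun x : A * A => mul x.1 x.2),
      hausdorff_space A &
      locally_compact [set: A]].

Definition covered_by_translates (A : zmodType) (X Y : set A) : Prop :=
  exists2 F : set A, finite_set F &
    Y `<=` \bigcup_(a in F) [set a + x | x in X].

Definition commensurable (A : zmodType) (X Y : set A) : Prop :=
  covered_by_translates X Y /\ covered_by_translates Y X.

Definition additively_symmetric (A : zmodType) (X : set A) : Prop :=
  X 0 /\ X = [set - x | x in X].

Definition approximate_subring (A : zmodType) (mul : A -> A -> A)
    (X : set A) : Prop :=
  additively_symmetric X /\
  covered_by_translates X
    ([set mul x y | x in X & y in X] `|` [set x + y | x in X & y in X]).

Definition uniformly_discrete (A : topologicalZmodType) (X : set A) : Prop :=
  exists2 W : set A, nbhs 0 W &
    forall x y, X x -> X y -> x <> y ->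
      [set x + w | w in W] `&` [set y + w | w in W] = set0.

Definition subring_set (A : zmodType) (mul : A -> A -> A) (D : set A) : Prop :=
  [/\ D 0, (forall x y, D x -> D y -> D (x - y)) &
      (forall x y, D x -> D y -> D (mul x y))].

Definition prod_mult (A B : Type) (mulA : A -> A -> A) (mulB : B -> B -> B)
    (x y : A * B) : A * B :=
  (mulA x.1 y.1, mulB x.2 y.2).

(* [D `<=` isolated D] says that the subspace topology of [D] is discrete. *)
Definition cut_and_project_scheme (A B : topologicalZmodType)
    (mulA : A -> A -> A) (mulB : B -> B -> B) (D : set (A * B)) : Prop :=
  [/\ locally_compact_ring mulA,
      locally_compact_ring mulB,
      subring_set (prod_mult mulA mulB) D,
      D `<=` isolated D &
      set_inj D fst].

Definition weak_model_set (A B : topologicalZmodType)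
    (mulA : A -> A -> A) (mulB : B -> B -> B) (M : set A) : Prop :=
  exists (D : set (A * B)) (W0 : set B),
    [/\ cut_and_project_scheme mulA mulB D,
        precompact W0,
        additively_symmetric W0,
        nbhs 0 W0 &
        M = fst @` (D `&` ([set: A] `*` W0))].

(* Up to isomorphism, an [n]-dimensional real algebra with its usual topology
   is R^n, with the topology of ['rV[R]_n], and an R-bilinear associative
   multiplication. *)
Definition real_algebra_mult (R : realType) (n : nat)
    (mul : 'rV[R]_n -> 'rV[R]_n -> 'rV[R]_n) : Prop :=
  [/\ ring_mult mul,
      (forall (a : R) x y, mul (a *: x) y = a *: mul x y) &
      (forall (a : R) x y, mul x (a *: y) = a *: mul x y)].

(* Main.v *)
(* Let L be the given set. Choose a finite set s with L + L inside s + L, so that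
   G = L + <s> is a group and each x in G is l + phi (c x), with l in L and c x
   an integer vector. Linear functionals bounded on K = phi^-1 L turn c into
   real quasi-morphisms, whose homogenizations give an additive map f from G to
   R^k. A descent in the lattice shows that every integer vector at which these
   functionals are bounded is near K, so the sets {x in G | |f x| <= r} are
   commensurable with L.

   Take such (k, G, f) with k minimal. Then each {x in G | |f x| <= e} generates
   G, for otherwise a coordinate could be dropped. Hence a homomorphism from G
   to an abelian group that takes finitely many values on {|f| <= 1} has finite
   image. Applied to the products modulo G, this gives a finite extension of G,
   and in it a subring D of finite index, to which f extends.

   Finally f (x y) is bounded when f x and f y are, so it is a bilinear function
   of (f x, f y); this is the multiplication of the internal space R^k, and the
   graph of f on D is the lattice of the cut-and-project scheme. *)
Require Import Defs.
From HB Require Import structures.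
From mathcomp Require Import all_boot all_order all_algebra.
From mathcomp Require Import all_classical all_reals all_analysis.
From mathcomp Require Import zify ring lra.
Import Order.TTheory GRing.Theory Num.Theory.
Import numFieldNormedType.Exports.
Local Open Scope classical_set_scope.
Local Open Scope ring_scope.

Set Implicit Arguments.
Unset Strict Implicit.
Unset Printing Implicit Defensive.

(** * Coverings by translates and additive maps *)

Section Translates.
Variable A : zmodType.
Implicit Types (X Y Z G : set A) (s : seq A).

Definition tcover X Y :=
  exists s, forall y, Y y -> exists2 a, a \in s & X (y - a).

Lemma covered_by_translatesE X Y : covered_by_translates X Y <-> tcover X Y.
Proof.
split=> [[F /finite_seqP[s ->] sub]|[s sP]].
  by exists s => y /sub[a /= as_ [x Xx <-]]; exists a; rewrite // addrC addKr.
exists [set` s]; first exact: finite_seq.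
move=> y /sP[a as_ Xya]; exists a => //; exists (y - a) => //.
by rewrite addrC subrK.
Qed.

Lemma tcover_subl X X' Y : X `<=` X' -> tcover X Y -> tcover X' Y.
Proof.
by move=> XX' [s sP]; exists s => y /sP[a as_ /XX' ?]; exists a.
Qed.

Lemma tcover_subr X Y Y' : Y' `<=` Y -> tcover X Y -> tcover X Y'.
Proof. by move=> YY' [s sP]; exists s => y /YY' /sP. Qed.

Lemma tcover_trans X Y Z : tcover X Y -> tcover Y Z -> tcover X Z.
Proof.
move=> [s sP] [t tP]; exists [seq a + b | a <- s, b <- t] => z.
move=> /tP[b bt /sP[a as_ Xa]]; exists (a + b); first exact: allpairs_f.
by rewrite opprD addrA addrAC.
Qed.

Lemma tcover_refl X : tcover X X.
Proof. by exists [:: 0] => x Xx; exists 0; rewrite ?inE// subr0. Qed.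

Lemma tcover_seq X s : X 0 -> tcover X [set` s].
Proof. by move=> X0; exists s => x xs; exists x => //; rewrite subrr. Qed.

Lemma tcoverU X Y Z : tcover X Y -> tcover X Z -> tcover X (Y `|` Z).
Proof.
move=> [s sP] [t tP]; exists (s ++ t) => x [/sP|/tP] [a ain Xa]; exists a => //;
by rewrite mem_cat ain ?orbT.
Qed.

Lemma tcover_bigU X (Y : A -> set A) s :
  (forall a, a \in s -> tcover X (Y a)) ->
  tcover X [set y | exists2 a, a \in s & Y a y].
Proof.
elim: s => [|b s IHs] H; first by exists [::] => y [].
apply: (@tcover_subr _ (Y b `|` [set y | exists2 a, a \in s & Y a y])).
  move=> y [a]; rewrite inE => /predU1P[->|as_] Yy; [by left|right].
  by exists a.
apply: tcoverU; first by apply: H; rewrite mem_head.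
by apply: IHs => a as_; apply: H; rewrite inE as_ orbT.
Qed.

(** Colours are a relation, so an element may carry several. One representative is kept for each
    colour that occurs, taken in [Y] itself. *)
Lemma colour_representatives (T : eqType) (c : A -> T -> Prop) (s : seq T) Y :
  (forall y, Y y -> exists2 t, t \in s & c y t) ->
  exists2 r : seq A, {in r, forall a, Y a} &
    forall y, Y y -> exists2 a, a \in r & exists2 t, c a t & c y t.
Proof.
move=> sP.
suff [r rY rP] : exists2 r : seq A, {in r, forall a, Y a} &
    forall y t, Y y -> t \in s -> c y t -> exists2 a, a \in r & c a t.
  exists r => // y Yy; have [t ts cyt] := sP y Yy.
  by have [a ar cat] := rP y t Yy ts cyt; exists a => //; exists t.
elim: s {sP} => [|u s [r rY rP]]; first by exists [::].
have [[b [Yb cbu]]|nb] := pselect (exists b, Y b /\ c b u).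
  exists (b :: r) => [a|y t Yy]; first by rewrite inE => /predU1P[->//|/rY].
  rewrite inE => /predU1P[-> _|ts cyt]; first by exists b; rewrite ?mem_head.
  by have [a ar cat] := rP y t Yy ts cyt; exists a => //; rewrite inE ar orbT.
exists r => // y t Yy; rewrite inE => /predU1P[-> cyu|]; last exact: rP.
by case: nb; exists y.
Qed.

(** Pigeonhole: the centres are one representative per colour. This is how coverings pass to smaller
    fibers and to stabilizers. *)
Lemma tcover_colour (T : eqType) (c : A -> T -> Prop) (s : seq T) Y Z :
  (forall y, Y y -> exists2 t, t \in s & c y t) ->
  (forall a y t, Y a -> Y y -> c a t -> c y t -> Z (y - a)) ->
  tcover Z Y.
Proof.
move=> /colour_representatives[r rY rP] cZ; exists r => y Yy.
by have [a ar [t cat cyt]] := rP y Yy; exists a => //; apply: cZ cat cyt; auto.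
Qed.

Definition additive_subgroup G := G 0 /\ forall x y, G x -> G y -> G (x - y).

Section Subgroup.
Variables (G : set A) (gG : additive_subgroup G).

Lemma subgroup0 : G 0. Proof. by case: gG. Qed.

Lemma subgroupB x y : G x -> G y -> G (x - y). Proof. by case: gG => _; exact. Qed.

Lemma subgroupN x : G x -> G (- x).
Proof. by move=> Gx; rewrite -sub0r; apply: subgroupB => //; exact: subgroup0. Qed.

Lemma subgroupD x y : G x -> G y -> G (x + y).
Proof. by move=> Gx Gy; rewrite -[y]opprK; apply/subgroupB/subgroupN. Qed.

Lemma subgroupMn x n : G x -> G (x *+ n).
Proof.
move=> Gx; elim: n => [|n IHn]; first exact: subgroup0.
by rewrite mulrS; exact: subgroupD.
Qed.

Lemma subgroupMz x n : G x -> G (x *~ n).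
Proof. by move=> Gx; case: n => n; [|apply: subgroupN]; exact: subgroupMn. Qed.

Lemma subgroup_sum (I : Type) (r : seq I) (F : I -> A) :
  (forall i, G (F i)) -> G (\sum_(i <- r) F i).
Proof.
move=> GF; elim/big_ind: _ => //; first exact: subgroup0.
by move=> x y; exact: subgroupD.
Qed.

(** A centre in use is [y - (y - a)] with both terms in [G], so the others can be discarded. *)
Lemma tcover_in X Y : X `<=` G -> Y `<=` G -> tcover X Y ->
  exists2 s : seq A, {in s, forall a, G a} &
    forall y, Y y -> exists2 a, a \in s & X (y - a).
Proof.
move=> XG YG [s sP]; exists [seq a <- s | `[< G a >]].
  by move=> a; rewrite mem_filter => /andP[/asboolP].
move=> y Yy; have [a as_ Xa] := sP y Yy; exists a => //.
rewrite mem_filter as_ andbT; apply/asboolP.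
have := subgroupB (YG _ Yy) (XG _ Xa).
by rewrite opprB addrC subrK.
Qed.

End Subgroup.

Definition generated_subgroup Y : set A :=
  [set x | forall G, additive_subgroup G -> Y `<=` G -> G x].

Lemma generated_subgroup_group Y : additive_subgroup (generated_subgroup Y).
Proof.
split=> [G gG _|x y Hx Hy G gG YG]; first exact: subgroup0 gG.
by apply: (subgroupB gG); [exact: Hx|exact: Hy].
Qed.

Lemma sub_generated Y : Y `<=` generated_subgroup Y.
Proof. by move=> y Yy G _; exact. Qed.

Lemma generated_sub Y G : additive_subgroup G -> Y `<=` G ->
  generated_subgroup Y `<=` G.
Proof. by move=> gG YG x; exact. Qed.

Definition additive_on (V : zmodType) G (f : A -> V) :=
  forall x y, G x -> G y -> f (x + y) = f x + f y.

Section AdditiveOn.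
Variables (V : zmodType) (G : set A) (gG : additive_subgroup G).
Variables (f : A -> V) (fD : additive_on G f).

Lemma additive_on0 : f 0 = 0.
Proof.
have G0 := subgroup0 gG.
by apply/eqP; rewrite -(inj_eq (addrI (f 0))) -fD// !addr0.
Qed.

Lemma additive_onN x : G x -> f (- x) = - f x.
Proof.
move=> Gx; apply/eqP; rewrite -addr_eq0 -fD//; last exact: subgroupN.
by rewrite addNr additive_on0.
Qed.

Lemma additive_onB x y : G x -> G y -> f (x - y) = f x - f y.
Proof. by move=> Gx Gy; rewrite fD ?additive_onN//; exact: subgroupN. Qed.

Lemma additive_onMn x n : G x -> f (x *+ n) = f x *+ n.
Proof.
move=> Gx; elim: n => [|n IHn]; first exact: additive_on0.
by rewrite !mulrS fD ?IHn//; exact: subgroupMn.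
Qed.

Lemma additive_onMz x n : G x -> f (x *~ n) = f x *~ n.
Proof.
move=> Gx; case: n => n; first exact: additive_onMn.
by rewrite !NegzE !mulrNz additive_onN ?additive_onMn//; exact: subgroupMn.
Qed.

Lemma additive_on_sum (I : Type) (r : seq I) (F : I -> A) :
  (forall i, G (F i)) -> f (\sum_(i <- r) F i) = \sum_(i <- r) f (F i).
Proof.
move=> GF; elim: r => [|i r IHr]; first by rewrite !big_nil additive_on0.
by rewrite !big_cons fD ?IHr//; exact: subgroup_sum.
Qed.

End AdditiveOn.

End Translates.

(** * Row vectors *)

Section RowVectors.
Variable R : realType.

Lemma norm_coord n (v : 'rV[R]_n) i : `|v 0 i| <= `|v|.
Proof.
rewrite -[leRHS]/(mx_norm v) mx_normrE.
by apply/bigmax_geP; right => /=; exists (0, i).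
Qed.

Lemma norm_le_coord n (v : 'rV[R]_n) r :
  0 <= r -> (forall i, `|v 0 i| <= r) -> `|v| <= r.
Proof.
move=> r0 vr; rewrite -[leLHS]/(mx_norm v) mx_normrE.
by apply/bigmax_leP; split => // -[i j] _ /=; rewrite ord1.
Qed.

Lemma int_box_finite n (B : nat) :
  exists s : seq 'rV[int]_n, forall v : 'rV[int]_n,
    (forall i, `|v 0 i| <= B%:Z) -> v \in s.
Proof.
exists (codom (fun g : {ffun 'I_n -> 'I_(B + B).+1} =>
  \row_i ((g i : nat)%:Z - B%:Z))) => v vB.
apply/codomP; exists [ffun i => inord `|(v 0 i + B%:Z)%R|%N].
apply/rowP => i; rewrite mxE ffunE inordK.
  by have := vB i; set a := v 0 i => ?; lia.
by have := vB i; set a := v 0 i => ?; lia.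
Qed.

(** The cells are the cubes of side [r] of a grid, indexed by floors; a ball meets finitely many. *)
Lemma norm_cells n (rho r : R) : 0 < r ->
  exists (c : 'rV[R]_n -> 'rV[int]_n) (s : seq 'rV[int]_n),
    (forall v, `|v| <= rho -> c v \in s) /\
    (forall v w, c v = c w -> `|v - w| <= r).
Proof.
move=> r0; pose c (v : 'rV[R]_n) := \row_i Num.floor (v 0 i / r).
have [s sP] := int_box_finite n (`|Num.floor (rho / r)| + 1)%N.
exists c, s; split=> [v vrho|v w /rowP cvw].
  apply: sP => i; rewrite mxE.
  have vi : `|v 0 i / r| <= rho / r.
    rewrite normrM [X in _ * X]gtr0_norm ?invr_gt0//.
    by rewrite ler_pM2r ?invr_gt0// (le_trans (norm_coord _ _)).
  have h1 := floor_itv (v 0 i / r); have h2 := floor_itv (rho / r).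
  move: vi; rewrite ler_norml => /andP[v1 v2].
  case/andP: h1 => h1 h1'; case/andP: h2 => h2 h2'.
  set a := Num.floor (v 0 i / r) in h1 h1' *.
  set b := Num.floor (rho / r) in h2 h2' *.
  have ab : a <= b by rewrite -ltzD1 -(ltr_int R); lra.
  have ab' : - b - 1 <= a.
    rewrite -ltzD1 -(ltr_int R) !intrD !mulrNz; rewrite intrD in h2' h1'; lra.
  by lia.
apply: norm_le_coord => [|i]; first exact: ltW.
have := cvw i; rewrite !mxE => e.
have h1 := floor_itv (v 0 i / r); have h2 := floor_itv (w 0 i / r).
rewrite e in h1; case/andP: h1 => h1 h1'; case/andP: h2 => h2 h2'.
have : `|v 0 i / r - w 0 i / r| <= 1.
  by rewrite ler_norml; rewrite !intrD in h1' h2'; lra.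
rewrite -mulrBl normrM [X in _ * X]gtr0_norm ?invr_gt0//.
by rewrite ler_pdivrMr// mul1r.
Qed.

End RowVectors.

(** A free family of maximal size: sizes are bounded by [k], and a vector of [S] outside the row
    space would enlarge the family. *)
Lemma maximal_free_rows (F : fieldType) k (S : set 'rV[F]_k) :
  exists m (E : 'M[F]_(m, k)), [/\ row_free E, forall i, S (row i E) &
    forall v, S v -> (v <= E)%MS].
Proof.
pose P m := `[< exists E : 'M[F]_(m, k), row_free E /\ forall i, S (row i E) >].
have P0 : exists m, P m.
  exists 0%N; apply/asboolP; exists 0; split => [|[]//].
  by rewrite /row_free mxrank0.
have Pk m : P m -> (m <= k)%N.
  by move=> /asboolP[E [Ef _]]; rewrite -(eqP Ef) rank_leq_col.
case: (ex_maxnP P0 Pk) => m /asboolP[E [Efree ES]] max_m.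
exists m, E; split => // v Sv; apply: contraPT isT => vE.
have /max_m : P (1 + m)%N; last by rewrite add1n ltnn.
apply/asboolP; exists (col_mx v E); split=> [|i]; last first.
  case: (split_ordP i) => j ->; last by rewrite rowKd.
  by rewrite rowKu ord1 row_id.
rewrite -row_leq_rank -addsmxE.
have := mxrank_leqif_sup (addsmxSr v E).
rewrite addsmx_sub (negPf vE) /= => /ltn_leqif.
by move: Efree; rewrite /row_free => /eqP -> ->.
Qed.

Lemma not_row_full_kernel (F : fieldType) m k (E : 'M[F]_(m, k)) :
  (m < k)%N -> exists2 u : 'cV[F]_k, u != 0 & E *m u = 0.
Proof.
move=> mk; have : cokermx E != 0.
  rewrite -mxrank_eq0 mxrank_coker subn_eq0 -ltnNge.
  exact: leq_ltn_trans (rank_leq_row E) mk.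
move=> /matrix0Pn[i [j cij]]; exists (col j (cokermx E)).
  by apply/matrix0Pn; exists i, 0; rewrite mxE.
by rewrite colE mulmxA mulmx_coker mul0mx.
Qed.

(** * Homogenization *)

Section Homogeneity.
Variable R : realType.

Lemma bounded_multiples_le0 (a C : R) : (forall n, a *+ n <= C) -> a <= 0.
Proof.
move=> aC; rewrite leNgt; apply/negP => a0.
have C0 : 0 <= C by have := aC 0%N.
have := archi_boundP (divr_ge0 C0 (ltW a0)).
by rewrite ltr_pdivrMr// mulr_natl ltNge aC.
Qed.

Lemma bounded_multiples_eq0 (V : normedZmodType R) (v : V) (C : R) :
  (forall n, `|v *+ n| <= C) -> v = 0.
Proof.
move=> vC; apply/eqP; rewrite -normr_le0; apply: (@bounded_multiples_le0 _ C).
by move=> n; rewrite -normrMn.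
Qed.

Section Homogenization.
Variables (A : zmodType) (G : set A) (gG : additive_subgroup G).
Variables (q : A -> R) (C : R).
Hypothesis qD : forall x y, G x -> G y -> `|q (x + y) - q x - q y| <= C.

Let C0 : 0 <= C.
Proof. by apply: le_trans (qD (subgroup0 gG) (subgroup0 gG)). Qed.

Lemma quasi_additiveMn x n : G x ->
  `|q (x *+ n.+1) - q x * n.+1%:R| <= C * n%:R.
Proof.
move=> Gx; elim: n => [|n IHn]; first by rewrite mulr1 subrr normr0 mulr0.
rewrite mulrSr -[n.+2]addn1 -[in leRHS]addn1 !natrD !mulrDr !mulr1.
have -> : q (x *+ n.+1 + x) - (q x * n.+1%:R + q x) =
    (q (x *+ n.+1) - q x * n.+1%:R) + (q (x *+ n.+1 + x) - q (x *+ n.+1) - q x).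
  by ring.
apply: le_trans (ler_normD _ _) _; apply: lerD => //.
by apply: qD => //; exact: subgroupMn.
Qed.

(** The limit of [q (x *+ n) / n], obtained as a supremum of lower estimates. It stays within [C] of
    [q] at every multiple of [x], so its additivity defect has bounded multiples and vanishes. *)
Lemma quasi_additive_homogenization :
  exists2 f : A -> R, additive_on G f & forall x, G x -> `|f x - q x| <= C.
Proof.
pose S x := [set (q (x *+ n.+1) - C) / n.+1%:R | n in [set: nat]].
(* Both sides are compared with [q] at the common multiple [x *+ (n.+1 * m.+1)]. *)
have key x n m : G x ->
    (q (x *+ n.+1) - C) / n.+1%:R <= (q (x *+ m.+1) + C) / m.+1%:R.
  move=> Gx; rewrite ler_pdivrMr ?ltr0Sn// mulrAC ler_pdivlMr ?ltr0Sn//.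
  have := quasi_additiveMn m (subgroupMn gG n.+1 Gx).
  have := quasi_additiveMn n (subgroupMn gG m.+1 Gx).
  rewrite -!mulrnA mulnC; set Q := q (x *+ (_ * _)).
  rewrite !ler_distl => /andP[h1 h2] /andP[h3 h4].
  have := C0; rewrite -[m.+1]addn1 -[n.+1]addn1 !natrD in h1 h2 h3 h4 *.
  lra.
have bounds x n : G x -> `|sup (S x) *+ n.+1 - q (x *+ n.+1)| <= C.
  move=> Gx; have n0 : (0 : R) < n.+1%:R by rewrite ltr0Sn.
  have S0 : S x !=set0 by exists ((q (x *+ 1) - C) / 1%:R); exists 0%N.
  have ub m : ubound (S x) ((q (x *+ m.+1) + C) / m.+1%:R).
    by move=> _ [p _ <-]; exact: key.
  have lo : (q (x *+ n.+1) - C) / n.+1%:R <= sup (S x).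
    by apply: ub_le_sup; [exists ((q (x *+ 1) + C) / 1%:R); exact: ub|exists n].
  have hi : sup (S x) <= (q (x *+ n.+1) + C) / n.+1%:R by exact: ge_sup.
  rewrite ler_pdivrMr// mulr_natr in lo; rewrite ler_pdivlMr// mulr_natr in hi.
  by rewrite ler_distl; apply/andP; split; lra.
exists (fun x => sup (S x)) => [x y Gx Gy|x /(bounds _ 0%N)]; last first.
  by rewrite !mulr1n.
apply/eqP; rewrite -subr_eq0; apply/eqP.
apply: (@bounded_multiples_eq0 R _ (C *+ 4)) => -[|n].
  by rewrite mulr0n normr0 mulrn_wge0// C0.
have := bounds _ n (subgroupD gG Gx Gy); have := bounds _ n Gx.
have := bounds _ n Gy.
have := qD (subgroupMn gG n.+1 Gx) (subgroupMn gG n.+1 Gy).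
rewrite -mulrnDl mulrnBl mulrnDl !ler_norml => /andP[? ?] /andP[? ?] /andP[? ?].
by move=> /andP[? ?]; apply/andP; split; lra.
Qed.

End Homogenization.

(** * Linearity of additive maps relative to a basis of values *)

Section Linearization.
Variables (A : zmodType) (G : set A) (gG : additive_subgroup G).
Variables (k : nat) (f : A -> 'rV[R]_k) (fD : additive_on G f).
Variables (d : 'I_k -> A) (E : 'M[R]_k).
Hypotheses (Eunit : E \in unitmx) (Gd : forall i, G (d i)).
Hypothesis fd : forall i, f (d i) = row i E.

Let co x := f x *m invmx E.

Lemma coordinatesE x : f x = \sum_i co x 0 i *: f (d i).
Proof.
rewrite -[LHS](mulmxKV Eunit) mulmx_sum_row.
by apply: eq_bigr => i _; rewrite fd.
Qed.

(** Floors of the coordinates of [f x] in the basis [f (d i)] leave a remainder with value in the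
    fundamental parallelepiped. *)
Lemma integral_part x : G x -> exists z (m : 'I_k -> int),
  [/\ G z, `|f z| <= \sum_i `|f (d i)|, x = z + \sum_i d i *~ m i &
      forall i, `|(m i)%:~R - co x 0 i| <= 1].
Proof.
move=> Gx; pose m i := Num.floor (co x 0 i).
have Gs : G (\sum_i d i *~ m i).
  by apply: subgroup_sum => // i; exact: subgroupMz.
have mP i : `|(m i)%:~R - co x 0 i| <= 1.
  have /andP[] := floor_itv (co x 0 i); rewrite intrD => h1 h2.
  by rewrite ler_norml; apply/andP; split; lra.
exists (x - \sum_i d i *~ m i), m; split=> //.
- exact: subgroupB.
- rewrite (additive_onB gG fD)// (additive_on_sum gG fD); last first.
    by move=> i; exact: subgroupMz.
  rewrite coordinatesE -sumrB; apply: le_trans (ler_norm_sum _ _ _) _.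
  apply: ler_sum => i _; rewrite (additive_onMz gG fD)// -scaler_int -scalerBl.
  rewrite normrZ; apply: ler_piMl => //.
  by rewrite distrC.
- by rewrite subrK.
Qed.

(** Splitting [x *+ n] by [integral_part] turns [n] times the defect of linearity into [g z] plus a
    combination of the [g (d i)] with coefficients at most 1. This bound is independent of [n], so
    the defect vanishes. *)
Lemma bounded_additive_linear m (g : A -> 'rV[R]_m) : additive_on G g ->
  (forall r, exists C, forall x, G x -> `|f x| <= r -> `|g x| <= C) ->
  forall x, G x -> g x = \sum_i co x 0 i *: g (d i).
Proof.
move=> gD gbd x Gx; apply/eqP; rewrite -subr_eq0; apply/eqP.
have [C gC] := gbd (\sum_i `|f (d i)|).
apply: (@bounded_multiples_eq0 'rV[R]_m _ (C + \sum_i `|g (d i)|)) => n.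
have [z [e [Gz fz xz eP]]] := integral_part (subgroupMn gG n Gx).
have -> : (g x - \sum_i co x 0 i *: g (d i)) *+ n =
   g z + \sum_i ((e i)%:~R - co (x *+ n) 0 i) *: g (d i).
  rewrite mulrnBl -(additive_onMn gG gD)// xz gD//; last first.
    by apply: subgroup_sum => // i; exact: subgroupMz.
  rewrite -addrA; congr (_ + _).
  rewrite (additive_on_sum gG gD); last by move=> i; exact: subgroupMz.
  rewrite -sumrMnl -sumrB; apply: eq_bigr => i _.
  rewrite -xz (additive_onMz gG gD)// scalerBl scaler_int; congr (_ - _).
  have -> : co (x *+ n) 0 i = co x 0 i *+ n.
    rewrite /co (additive_onMn gG fD)// -[f x *+ n]scaler_nat -scalemxAl.
    by rewrite [LHS]mxE mulr_natl.
  by rewrite scalerMnl.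
apply: le_trans (ler_normD _ _) _; apply: lerD; first exact: gC.
apply: le_trans (ler_norm_sum _ _ _) _; apply: ler_sum => i _.
by rewrite normrZ; apply: ler_piMl.
Qed.

End Linearization.
End Homogeneity.

(** * Descent in the lattice *)

Section Descent.
Variable R : realType.

Definition dot r (u v : 'rV[R]_r) : R := \sum_i u 0 i * v 0 i.

Lemma dotC r (u v : 'rV[R]_r) : dot u v = dot v u.
Proof. by apply: eq_bigr => i _; rewrite mulrC. Qed.

Lemma dotDr r (u v w : 'rV[R]_r) : dot u (v + w) = dot u v + dot u w.
Proof. by rewrite -big_split; apply: eq_bigr => i _; rewrite mxE mulrDr. Qed.

Lemma dotNr r (u v : 'rV[R]_r) : dot u (- v) = - dot u v.
Proof. by rewrite -sumrN; apply: eq_bigr => i _; rewrite mxE mulrN. Qed.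

Lemma dotBr r (u v w : 'rV[R]_r) : dot u (v - w) = dot u v - dot u w.
Proof. by rewrite dotDr dotNr. Qed.

Lemma dotZr r a (u v : 'rV[R]_r) : dot u (a *: v) = a * dot u v.
Proof. by rewrite mulr_sumr; apply: eq_bigr => i _; rewrite mxE mulrCA. Qed.

Lemma dot_submx r n (E : 'M[R]_(n, r)) (u v : 'rV[R]_r) :
  (forall i, dot (row i E) v = 0) -> (u <= E)%MS -> dot u v = 0.
Proof.
move=> Ev /submxP[a ->]; have -> : a *m E = \sum_i a 0 i *: row i E.
  exact: mulmx_sum_row.
rewrite dotC; elim/big_ind: _ => [|x y x0 y0|i _].
  by rewrite -(scale0r 0) dotZr mul0r.
  by rewrite dotDr x0 y0 addr0.
by rewrite dotZr dotC Ev mulr0.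
Qed.

Lemma dot_ge0 r (u : 'rV[R]_r) : 0 <= dot u u.
Proof. by apply: sumr_ge0 => i _; rewrite -expr2 sqr_ge0. Qed.

Lemma dot_eq0 r (u : 'rV[R]_r) : dot u u = 0 -> u = 0.
Proof.
move=> u0; apply/rowP => i; rewrite mxE; apply/eqP; rewrite -sqrf_eq0.
have /psumr_eq0P : forall j, true -> 0 <= u 0 j * u 0 j.
  by move=> j _; rewrite -expr2 sqr_ge0.
by move=> /(_ u0 i isT) /eqP; rewrite -expr2.
Qed.

Lemma norm_dot_le r (u v : 'rV[R]_r) : `|dot u v| <= (\sum_i `|u 0 i|) * `|v|.
Proof.
apply: le_trans (ler_norm_sum _ _ _) _; rewrite mulr_suml.
by apply: ler_sum => i _; rewrite normrM ler_wpM2l// norm_coord.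
Qed.

(** Compactness of the unit sphere; terms of arbitrarily large index take the place of a
    subsequence. *)
Lemma unit_sequence_cluster r (u : nat -> 'rV[R]_r) : (forall n, `|u n| = 1) ->
  exists2 v : 'rV[R]_r, `|v| = 1 &
    forall e N, 0 < e -> exists2 n, (N <= n)%N & `|v - u n| < e.
Proof.
move=> u1; have cS : compact [set v : 'rV[R]_r | `|v| = 1].
  apply: bounded_closed_compact.
    by exists 1; split; [exact: num_real|move=> M M1 v /= ->; exact: ltW].
  exact: ((continuous_closedP _).1 (@norm_continuous R 'rV[R]_r) _ (@closed_eq R 1)).
have [|v [v1 cv]] := cS (u @ \oo) _; first by exists 0%N => // n _; exact: u1.
exists v => // e N e0.
have uN : (u @ \oo) [set u n | n in [set n | (N <= n)%N]].
  by exists N => // n /= Nn; exists n.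
have [_ [[n /= Nn <-] ]] := cv _ _ uN (nbhsx_ballx v e e0).
by rewrite mx_norm_ball; exists n.
Qed.

(* A sequence of unbounded such [d] has a limit direction [u], orthogonal to
   the rows of [E], with [dot u k <= 1] for all [k] in [K]. *)
Lemma bounded_displacements r n (E : 'M[R]_(n, r)) (K : set 'rV[R]_r)
    (Q : 'rV[R]_r -> R) (C : R) :
  (forall u, (forall i, dot (row i E) u = 0) -> u != 0 ->
    exists2 k, K k & 3 < dot u k) ->
  exists B : R, forall d, (forall i, `|dot (row i E) d| <= C) ->
    (forall k, K k -> dot d k <= `|d| + Q k) -> `|d| <= B.
Proof.
move=> HK; apply: contrapT => /forallNP nB.
have /choice[d dP] (B : nat) : exists d : 'rV[R]_r,
    [/\ forall i, `|dot (row i E) d| <= C,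
        forall k, K k -> dot d k <= `|d| + Q k & B%:R < `|d|].
  have /existsNP[d dP] := nB B%:R; exists d.
  apply: contrapT => nd; apply: dP => dE dK; rewrite leNgt; apply/negP => Bd.
  by apply: nd; split.
have d_gt0 B : 0 < `|d B|.
  by have [_ _] := dP B; apply: le_lt_trans; rewrite ler0n.
pose u B := `|d B|^-1 *: d B.
have [B|v v1 vP] := @unit_sequence_cluster r u.
  by rewrite normfZV// -normr_gt0.
have [||k Kk vk] := HK v.
(* [dot (row i E) (d B)] is bounded while the norm of [d B] grows. Half of [e] goes to [u B], half
   to the distance from [u B] to [v]. *)
- move=> i; apply/eqP; rewrite -normr_le0; apply/ler_addgt0Pr => e e0.
  rewrite add0r; set S := \sum_j `|(row i E) 0 j|.
  have S0 : 0 <= S by apply: sumr_ge0.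
  have C0 : 0 <= C by have [/(_ i) + _ _] := dP 0%N; apply: le_trans.
  pose e' := e / 2 / (S + 1); have e'0 : 0 < e' by rewrite !divr_gt0//; lra.
  have [B BN vB] := vP e' (Num.bound (2 * C / e)) e'0.
  have := norm_dot_le (row i E) (v - u B); rewrite -/S dotBr => h.
  have h1 : `|dot (row i E) (u B)| <= e / 2.
    rewrite dotZr normrM gtr0_norm ?invr_gt0// mulrC ler_pdivrMr//.
    have [/(_ i) hC _ dB] := dP B; apply: (le_trans hC).
    have bC : 2 * C / e < B%:R.
      apply: lt_le_trans (archi_boundP _) _; last by rewrite ler_nat.
      by rewrite divr_ge0// ?mulr_ge0// ltW.
    rewrite ltr_pdivrMr// in bC; have : B%:R * e <= `|d B| * e.
      by rewrite ler_pM2r// ltW.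
    lra.
  have h2 : S * `|v - u B| <= e / 2.
    apply: (@le_trans _ _ ((S + 1) * e')).
      by apply: ler_pM => //; [lra|exact: ltW].
    by rewrite /e' mulrC divfK//; lra.
  rewrite -[dot (row i E) v](subrK (dot (row i E) (u B))).
  apply: le_trans (ler_normD _ _) _; lra.
- by rewrite -normr_gt0 v1.
set S := \sum_j `|k 0 j|; have S0 : 0 <= S by apply: sumr_ge0.
pose e' := 1 / (S + 1); have e'0 : 0 < e' by rewrite !divr_gt0//; lra.
have [B BN vB] := vP e' (Num.bound `|Q k|) e'0.
have := norm_dot_le k (v - u B); rewrite -/S dotBr => h.
have h2 : S * `|v - u B| <= 1.
  apply: (@le_trans _ _ ((S + 1) * e')).
    by apply: ler_pM => //; [lra|exact: ltW].
  by rewrite /e' mulrC divfK//; lra.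
have [_ /(_ k Kk) dk dB] := dP B.
(* For large [B] this makes [dot k (u B)] at most 2; replacing [u B] by [v] adds at most 1, against
   [3 < dot v k]. *)
have QB : Q k <= `|d B|.
  apply: le_trans (ler_norm _) _; apply/ltW/(le_lt_trans _ dB)/ltW.
  by apply: lt_le_trans (archi_boundP _) _; rewrite ?ler_nat.
have : dot k (u B) <= 2.
  by rewrite dotZr mulrC ler_pdivrMr// dotC; lra.
move: (le_trans h h2); rewrite ler_norml (dotC k v) => /andP[]; lra.
Qed.

End Descent.

(** * Integer vectors near a symmetric set [K] *)

Section IntegerDescent.
Variable R : realType.

Definition introw r (m : 'rV[int]_r) : 'rV[R]_r := map_mx intr m.

Lemma introwD r (m p : 'rV[int]_r) : introw (m + p) = introw m + introw p.
Proof. by apply/rowP => i; rewrite !mxE intrD. Qed.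

Lemma introwN r (m : 'rV[int]_r) : introw (- m) = - introw m.
Proof. by apply/rowP => i; rewrite !mxE mulrNz. Qed.

Lemma norm_introw_delta r (i : 'I_r) : `|introw (delta_mx 0 i)| <= 1.
Proof.
apply: norm_le_coord => // j; rewrite !mxE eqxx /=.
by case: (j == i); rewrite ?normr1 ?normr0.
Qed.

Lemma norm_dot_delta r (v : 'rV[R]_r) i :
  `|dot v (introw (delta_mx 0 i))| <= \sum_j `|v 0 j|.
Proof.
apply: le_trans (norm_dot_le _ _) _; apply: ler_piMr; last exact: norm_introw_delta.
exact: sumr_ge0.
Qed.

Variables (r n : nat) (E : 'M[R]_(n, r)) (K : set 'rV[int]_r).
Hypotheses (K0 : K 0) (KN : forall m, K m -> K (- m)).
Hypothesis KD : forall m p, K m -> K p -> exists i, K (m + p - delta_mx 0 i).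
Hypothesis Ebounded : forall i, exists C, forall m, K m ->
  `|dot (row i E) (introw m)| <= C.
Hypothesis Emax : forall v,
  (exists C, forall m, K m -> `|dot v (introw m)| <= C) -> (v <= E)%MS.

(* Given [z], move from a point [m] of [K] nearest to [z] by an element [k] of
   [K]: minimality bounds [dot (z - m) k]. *)
Lemma integer_descent C : exists B : nat, forall z,
  (forall i, `|dot (row i E) (introw z)| <= C) ->
  exists2 m, K m & forall i, `|(z - m) 0 i| <= B%:Z.
Proof.
have [CE CEP] := choice Ebounded.
(* The index provided by [KD] is not known in advance, so [Q] sums over all unit vectors. *)
pose Q (k : 'rV[R]_r) :=
  \sum_i dot (k - introw (delta_mx 0 i)) (k - introw (delta_mx 0 i)).
have [|B BP] :=
  @bounded_displacements R r n E (@introw r @` K) Q (C + \sum_i `|CE i|).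
  (* If [dot u] is at most 3 on [K], it is bounded there by symmetry, so [u] is in the row space of
     [E] by [Emax]; being orthogonal to the rows, it is 0. *)
  move=> u Eu u0; apply: contrapT => nk; move/eqP: u0; apply.
  apply: dot_eq0; apply: dot_submx Eu _; apply: Emax; exists 3.
  have le3 m : K m -> dot u (introw m) <= 3.
    move=> Km; rewrite leNgt; apply/negP => h; apply: nk.
    by exists (introw m) => //; exists m.
  move=> m Km; rewrite ler_norml le3// andbT lerNl -dotNr -introwN.
  by apply: le3; exact: KN.
exists (Num.bound `|B|) => z Ez.
(* The squared Euclidean length is a natural number, so a nearest point of [K] exists. *)
pose sq (v : 'rV[int]_r) := (\sum_i `|v 0%R i| ^ 2)%N.
have sqE v : (sq v)%:R = dot (introw v) (introw v).
  rewrite natr_sum; apply: eq_bigr => i _; rewrite mxE natrX -expr2.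
  by rewrite -[RHS]real_normK ?num_real// natr_absz intr_norm.
pose P a := `[< exists2 m, K m & sq (z - m) = a >].
have exP : exists a, P a by exists (sq (z - 0)); apply/asboolP; exists 0.
case: (ex_minnP exP) => a /asboolP[m Km ma] min_a.
exists m => // i.
have : `|introw (z - m)| <= B.
  apply: BP => [j|_ [p Kp <-]].
    rewrite introwD introwN dotBr; apply: le_trans (ler_normB _ _) _.
    apply: lerD => //; apply: le_trans (CEP j m Km) _.
    apply: le_trans (ler_norm _) _.
    by rewrite (bigD1 j)//= lerDl; exact: sumr_ge0.
  (* The competitor [m + p - delta_mx 0 j] is no nearer to [z]; expanding the squares bounds
     [dot d k] by [dot d e] plus half of [Q k]. *)
  have [j Kj] := KD Km Kp.
  have /min_a : P (sq (z - (m + p - delta_mx 0 j))).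
    by apply/asboolP; exists (m + p - delta_mx 0 j).
  rewrite -ma -(ler_nat R) !sqE.
  have -> : introw (z - (m + p - delta_mx 0 j)) =
      introw (z - m) - (introw p - introw (delta_mx 0 j)).
    by rewrite -!(introwN, introwD) -[m + p - _]addrA opprD addrA.
  set d := introw (z - m); set k := introw p; set e := introw (delta_mx 0 j).
  have Qk : dot (k - e) (k - e) <= Q k.
    rewrite /Q (bigD1 j)//= -/e lerDl; apply: sumr_ge0 => l _.
    exact: dot_ge0.
  have de : `|dot d e| <= `|d|.
    have eE l : e 0 l = (l == j)%:R by rewrite !mxE eqxx; case: (l == j).
    rewrite /dot (bigD1 j)//= big1 => [|l lj]; last first.
      by rewrite eE (negPf lj) mulr0.
    by rewrite eE eqxx addr0 mulr1; exact: norm_coord.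
  have := dot_ge0 (k - e).
  rewrite [dot (d - _) _]dotBr [dot (d - _) d]dotC [dot (d - _) (k - e)]dotC !dotBr.
  rewrite (dotC (k - e) d) !dotBr; rewrite !dotBr in Qk.
  move: de; rewrite ler_norml => /andP[]; lra.
move=> zB; rewrite -(ler_int R) intr_norm.
have := le_trans (norm_coord (introw (z - m)) i) zB; rewrite mxE => /le_trans; apply.
apply: le_trans (ler_norm _) _; apply/ltW; exact: archi_boundP.
Qed.

End IntegerDescent.

(** * Linear models of approximate subgroups *)

Lemma subrBB (V : zmodType) (x y a b : V) : (x - y) - (a - b) = (x - a) - (y - b).
Proof. by rewrite !opprB addrACA [- y - a]addrC -addrACA. Qed.

Section AdditiveModel.
Variables (R : realType) (A : zmodType).
Implicit Types (G L X : set A).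

Definition fiber k G (f : A -> 'rV[R]_k) r : set A := [set x | G x /\ `|f x| <= r].

(** Colour [Y] by the grid cell of the value of [f]. *)
Lemma tcover_fiber k G (f : A -> 'rV[R]_k) (Y : set A) rho r :
  additive_subgroup G -> additive_on G f -> Y `<=` fiber G f rho -> 0 < r ->
  tcover [set x | exists a b, [/\ Y a, Y b, x = a - b & fiber G f r x]] Y.
Proof.
move=> gG fD YG r0; have [c [s [cs cP]]] := @norm_cells R k rho r r0.
apply: (@tcover_colour _ _ (fun y t => c (f y) = t) s).
  by move=> y /YG[_ fy]; exists (c (f y)) => //; exact: cs.
move=> a y _ Ya Yy <- ca; exists y, a; split => //.
have [Ga _] := YG _ Ya; have [Gy _] := YG _ Yy.
by split; [exact: subgroupB|rewrite (additive_onB gG fD)//; exact: cP].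
Qed.

Section FromApproximateSubgroup.
Variables (L X : set A).
Hypotheses (L0 : L 0) (LN : forall x, L x -> L (- x)).
Hypothesis LD : tcover L [set x + y | x in L & y in L].
Hypotheses (gX : additive_subgroup X) (LX : L `<=` X).

(** The ambient group [X] confines [G]; the multipliers of [L] will take its place. *)
Lemma additive_model : exists k G (f : A -> 'rV[R]_k),
  [/\ additive_subgroup G, L `<=` G /\ G `<=` X, additive_on G f,
      exists C, L `<=` fiber G f C & forall r, tcover L (fiber G f r)].
Proof.
have [s sX sL] : exists2 s : seq A, {in s, forall a, X a} &
    forall x y, L x -> L y -> exists2 a, a \in s & L (x + y - a).
  have [||s sX sL] := tcover_in gX _ _ LD; [exact: LX| |].
    by move=> _ [x Lx [y Ly <-]]; apply: subgroupD => //; exact: LX.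
  by exists s => // x y Lx Ly; apply: sL; exists x => //; exists y.
pose r := size s; pose phi (m : 'rV[int]_r) := \sum_(i < r) s`_i *~ m 0 i.
have phiD m p : phi (m + p) = phi m + phi p.
  by rewrite -big_split; apply: eq_bigr => i _; rewrite mxE mulrzDr.
have phiN m : phi (- m) = - phi m.
  by rewrite -sumrN; apply: eq_bigr => i _; rewrite mxE mulrNz.
have phi0 : phi 0 = 0 by rewrite /phi big1// => i _; rewrite mxE.
have phi_delta i : phi (delta_mx 0 i) = s`_i.
  rewrite /phi (bigD1 i)//= big1 => [|j ji]; first by rewrite mxE !eqxx addr0.
  by rewrite mxE eqxx (negPf ji).
(* The centres in [s] are the images of the unit vectors. *)
have LDs x y : L x -> L y -> exists i, L (x + y - phi (delta_mx 0 i)).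
  move=> Lx Ly; have [a as_ La] := sL x y Lx Ly.
  have ia : (index a s < r)%N by rewrite index_mem.
  by exists (Ordinal ia); rewrite phi_delta /= nth_index.
have phiX m : X (phi m).
  apply: subgroup_sum => // i; apply: subgroupMz => //; apply: sX.
  exact: mem_nth.
pose G := [set x | exists m, L (x - phi m)].
have LG : L `<=` G by move=> x Lx; exists 0; rewrite phi0 subr0.
have gG : additive_subgroup G.
  split=> [|x y [m Lm] [p Lp]]; first exact: LG.
  have [i] := LDs _ _ Lm (LN Lp); rewrite subrBB => Li.
  by exists (m - p + delta_mx 0 i); rewrite !phiD phiN opprD addrA.
have GX : G `<=` X.
  by move=> x [m /LX Xm]; rewrite -(subrK (phi m) x); exact: subgroupD.
pose K := [set m | L (phi m)].
have K0 : K 0 by rewrite /K/= phi0.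
have KN m : K m -> K (- m) by rewrite /K/= phiN; exact: LN.
(* Each addition in [L] costs one unit vector. *)
have K2 m x y : L x -> L y -> phi m = x + y -> exists i, K (m - delta_mx 0 i).
  move=> Lx Ly mE; have [i Li] := LDs x y Lx Ly; exists i.
  by rewrite /K/= phiD phiN mE.
have K3 m x y z : L x -> L y -> L z -> phi m = x + y + z ->
    exists i j, K (m - delta_mx 0 i - delta_mx 0 j).
  move=> Lx Ly Lz mE; have [i Li] := LDs x y Lx Ly; exists i.
  by apply: (K2 _ _ z Li) => //; rewrite phiD phiN mE addrAC.
have KD m p : K m -> K p -> exists i, K (m + p - delta_mx 0 i).
  by move=> Km Kp; apply: K2 Km Kp _; rewrite phiD.
pose H := [set v : 'rV[R]_r |
  exists C, forall m, K m -> `|dot v (introw R m)| <= C].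
have [k [E [_ EH Emax]]] := maximal_free_rows H.
have [CE CEP] := choice EH.
pose S i := \sum_j `|(row i E) 0 j|.
(* Integer coordinates modulo [L]; the value outside [G] is arbitrary. *)
have /choice[c cP] x : exists m, G x -> L (x - phi m).
  by have [[m Lm]|nG] := pselect (G x); [exists m|exists 0].
pose q i x := dot (row i E) (introw R (c x)).
(* [c (x + y) - c x - c y] is in [K] up to two unit vectors, each contributing at most [S i]. *)
have qD i x y : G x -> G y -> `|q i (x + y) - q i x - q i y| <= CE i + S i + S i.
  move=> Gx Gy; set m := c (x + y) - c x - c y.
  have [||||a [b Kab]] := K3 m (x - phi (c x)) (y - phi (c y))
    (- (x + y - phi (c (x + y)))).
  - exact: cP.
  - exact: cP.
  - by apply/LN/cP; exact: subgroupD.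
  - by rewrite !phiD !phiN addrACA -opprD subrBB subrr sub0r opprB opprD addrA.
  have -> : q i (x + y) - q i x - q i y = dot (row i E) (introw R m).
    by rewrite /m !introwD !introwN !dotDr !dotNr.
  rewrite -(subrK (delta_mx 0 a) m) -(subrK (delta_mx 0 b) (m - _)).
  rewrite introwD dotDr introwD dotDr.
  do 2!(apply: le_trans (ler_normD _ _) _; apply: lerD; last exact: norm_dot_delta).
  exact: CEP.
have /choice[fc fcP] i : exists f, additive_on G f /\
    forall x, G x -> `|f x - q i x| <= CE i + S i + S i.
  have [f fD fq] := quasi_additive_homogenization gG (qD i).
  by exists f.
pose f x : 'rV[R]_k := \row_i fc i x.
have T0 i : 0 <= CE i + S i + S i.
  by have [_ fq] := fcP i; apply: le_trans (fq 0 (subgroup0 gG)).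
exists k, G, f; split => //.
- by move=> x y Gx Gy; apply/rowP => i; rewrite !mxE (fcP i).1.
(* For [x] in [L], [phi (c x)] is a sum of two elements of [L], so [q i x] is bounded by
   [CE i + S i]. Adding the homogenization error stays below twice that error. *)
- exists (\sum_i (CE i + S i + S i) *+ 2) => x Lx; split; first exact: LG.
  apply: norm_le_coord => [|i]; first by apply: sumr_ge0 => i _; rewrite mulrn_wge0.
  rewrite mxE; apply: (@le_trans _ _ ((CE i + S i + S i) *+ 2)); last first.
    by rewrite (bigD1 i)//= lerDl; apply: sumr_ge0 => j _; rewrite mulrn_wge0.
  have [|||a] := K2 (c x) x (- (x - phi (c x))).
  - by [].
  - by apply/LN/cP; exact: LG.
  - by rewrite opprB addrC subrK.
  move=> /(CEP i); rewrite introwD introwN dotBr => h.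
  have [_ /(_ x (LG x Lx))] := fcP i; rewrite /q.
  have := norm_dot_delta (row i E) a; rewrite -/(S i).
  move: h; rewrite !ler_norml => /andP[? ?] /andP[? ?] /andP[? ?].
  have : 0 <= S i by exact: sumr_ge0.
  by move=> ?; apply/andP; split; lra.
(* A bound on [f x] bounds the functionals at [c x], so [c x] is near some [m] in [K]. Then [x] is
   the sum of [x - phi (c x)], [phi m] and one of finitely many [phi (c x - m)]. *)
- move=> rho; have [B BP] := integer_descent K0 KN KD EH Emax
    (rho + \sum_i (CE i + S i + S i)).
  have [t tP] := int_box_finite r B.
  apply: (@tcover_trans _ _ [set x + y | x in L & y in L]) => //.
  exists (map phi t) => x [Gx fx]; have [m Km mB] : exists2 m, K m &
      forall i, `|(c x - m) 0 i| <= B%:Z.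
    apply: BP => i; have [_ /(_ x Gx)] := fcP i; rewrite -/(q i x) => fq.
    have -> : q i x = f x 0 i - (fc i x - q i x) by rewrite mxE; lra.
    apply: le_trans (ler_normB _ _) _; apply: lerD.
      exact: le_trans (norm_coord _ _) fx.
    apply: (le_trans fq); rewrite (bigD1 i)//= lerDl; exact: sumr_ge0.
  exists (phi (c x - m)); first by apply: map_f; exact: tP.
  exists (x - phi (c x)); first exact: cP.
  by exists (phi m) => //; rewrite phiD phiN opprD opprK addrA.
Qed.

End FromApproximateSubgroup.
End AdditiveModel.

(** * Linear models of approximate rings *)

Section TorsionExtension.
Variables (A : zmodType) (n : nat).
Hypothesis n_gt0 : (0 < n)%N.
Implicit Types (G X : set A).

(** Add to [G] the multiples of [a]; by division with remainder, the [a *+ i] with [i < n] represent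
    all cosets. *)
Lemma torsion_extension1 G a : additive_subgroup G -> G (a *+ n) ->
  exists G', [/\ additive_subgroup G', G `<=` G', G' a, tcover G G' &
    (forall x, G' x -> G (x *+ n)) /\
    forall X, additive_subgroup X -> G `<=` X -> X a -> G' `<=` X].
Proof.
move=> gG Gna; exists [set x | exists m, G (x - a *~ m)]; split.
- split=> [|x y [m Gm] [p Gp]]; first by exists 0; rewrite subr0; exact: subgroup0.
  by exists (m - p); rewrite mulrzBr subrBB; exact: subgroupB.
- by move=> x Gx; exists 0; rewrite subr0.
- by exists 1; rewrite subrr; exact: subgroup0.
- exists [seq a *+ i | i <- iota 0 n] => x [m Gm].
  have n0 : n%:Z != 0 by lia.
  exists (a *+ `|(m %% n)%Z|).
    by apply: map_f; rewrite mem_iota add0n -ltz_nat gez0_abs ?ltz_pmod ?modz_ge0.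
  have -> : a *+ `|(m %% n)%Z| = a *~ (m %% n)%Z.
    by rewrite pmulrn gez0_abs ?modz_ge0.
  have -> : x - a *~ (m %% n)%Z = (x - a *~ m) + a *+ n *~ (m %/ n)%Z.
    have -> : a *~ m = a *+ n *~ (m %/ n)%Z + a *~ (m %% n)%Z.
      by rewrite {1}(divz_eq m n) mulrzDr pmulrn -mulrzA [n%:Z * _]mulrC.
    by rewrite opprD addrA addrAC subrK.
  by apply: subgroupD => //; exact: subgroupMz.
- split=> [x [m Gm]|X gX GX Xa x [m /GX Xm]].
    rewrite -(subrK (a *~ m) x) mulrnDl; apply: subgroupD => //.
      exact: subgroupMn.
    by rewrite pmulrn -mulrzA mulrC mulrzA -pmulrn; exact: subgroupMz.
  by rewrite -(subrK (a *~ m) x); apply: subgroupD => //; exact: subgroupMz.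
Qed.

(** Adjoin the elements one by one; the exponents multiply. Minimality of [G'] will keep it inside
    the multipliers. *)
Lemma torsion_extension G (s : seq A) : additive_subgroup G ->
  {in s, forall a, G (a *+ n)} ->
  exists G', [/\ additive_subgroup G', G `<=` G', {in s, forall a, G' a},
    tcover G G' &
    (exists N, (0 < N)%N /\ forall x, G' x -> G (x *+ N)) /\
    forall X, additive_subgroup X -> G `<=` X -> {in s, forall a, X a} -> G' `<=` X].
Proof.
move=> gG; elim: s => [|a s IHs] sn.
  exists G; split => //; first exact: tcover_refl.
  by split => //; exists 1%N.
have [|G' [gG' GG' sG' cG' [[N [N0 NG']] G'X]]] := IHs.
  by move=> b bs; apply: sn; rewrite inE bs orbT.
have [|H [gH G'H Ha cH [nH HX]]] := @torsion_extension1 G' a gG'.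
  by apply/GG'/sn; rewrite mem_head.
exists H; split => //.
- by move=> x /GG'/G'H.
- by move=> b; rewrite inE => /predU1P[->//|/sG'/G'H].
- exact: tcover_trans cG' cH.
split=> [|X gX GX sX].
  exists (n * N)%N; split; first by rewrite muln_gt0 n_gt0.
  by move=> x /nH/NG'; rewrite mulrnA.
apply: HX => //; last by apply: sX; rewrite mem_head.
by apply: G'X => // b bs; apply: sX; rewrite inE bs orbT.
Qed.

End TorsionExtension.

Section ApproximateRing.
Variables (R : realType) (A : zmodType) (mul : A -> A -> A) (L : set A).
Implicit Types (G X Y Z : set A) (s t : seq A).
Hypothesis hmul : ring_mult mul.
Hypotheses (L0 : L 0) (LN : forall x, L x -> L (- x)).
Hypothesis LD : tcover L [set x + y | x in L & y in L].
Hypothesis LM : tcover L [set mul x y | x in L & y in L].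

Let mulA x y z : mul x (mul y z) = mul (mul x y) z. Proof. by case: hmul. Qed.
Let mulDl x y z : mul (x + y) z = mul x z + mul y z. Proof. by case: hmul. Qed.
Let mulDr x y z : mul x (y + z) = mul x y + mul x z. Proof. by case: hmul. Qed.
Let gT : additive_subgroup [set: A]. Proof. by []. Qed.
Let mulxD x : additive_on [set: A] (mul x).
Proof. by move=> y z _ _; exact: mulDr. Qed.
Let mulDx x : additive_on [set: A] (mul^~ x).
Proof. by move=> y z _ _; exact: mulDl. Qed.
Let mulBr x y z : mul x (y - z) = mul x y - mul x z.
Proof. exact: (additive_onB gT (mulxD x)). Qed.
Let mulBl x y z : mul (x - y) z = mul x z - mul y z.
Proof. exact: (additive_onB gT (mulDx z)). Qed.
Let mul0l x : mul 0 x = 0. Proof. exact: (additive_on0 gT (mulDx x)). Qed.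
Let mul0r x : mul x 0 = 0. Proof. exact: (additive_on0 gT (mulxD x)). Qed.
Let mulMnr x y n : mul x (y *+ n) = mul x y *+ n.
Proof. exact: (additive_onMn gT (mulxD x)). Qed.

Lemma tcoverD Y Z : tcover L Y -> tcover L Z ->
  tcover L [set y + z | y in Y & z in Z].
Proof.
move=> [s sP] [t tP]; apply: tcover_trans LD _.
exists [seq a + b | a <- s, b <- t] => _ [y /sP[a as_ La] [z /tP[b bt Lb] <-]].
exists (a + b); first exact: allpairs_f.
by exists (y - a) => //; exists (z - b) => //; rewrite opprD addrACA.
Qed.

Lemma tcoverN Y : tcover L Y -> tcover L [set - y | y in Y].
Proof.
move=> [s sP]; exists [seq - a | a <- s] => _ [y /sP[a as_ La] <-].
by exists (- a); [exact: map_f|rewrite -opprD; exact: LN].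
Qed.

Lemma tcoverB Y Z : tcover L Y -> tcover L Z ->
  tcover L [set y - z | y in Y & z in Z].
Proof.
move=> cY /tcoverN/(tcoverD cY); apply: tcover_subr => _ [y Yy [z Zz <-]].
by exists y => //; exists (- z) => //; exists z.
Qed.

Lemma tcover_image (h : A -> A) Y Z : additive_on [set: A] h ->
  tcover Y Z -> tcover [set h y | y in Y] [set h z | z in Z].
Proof.
move=> hD [s sP]; exists (map h s) => _ [z /sP[a as_ Ya] <-].
exists (h a); first exact: map_f.
by exists (z - a) => //; exact: (additive_onB gT hD).
Qed.

(** A product of two translates of [L] is controlled when their centres lie here. This is a subring
    containing [L]. *)
Definition multiplier : set A := [set x |
  tcover L [set mul x y | y in L] /\ tcover L [set mul y x | y in L]].

Lemma multiplier_group : additive_subgroup multiplier.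
Proof.
have c0 : tcover L [set 0].
  by exists [:: 0] => _ ->; exists 0; rewrite ?mem_head// subrr.
split=> [|x y [xl xr] [yl yr]].
  by split; apply: tcover_subr c0 => _ [y _ <-]; rewrite ?mul0l ?mul0r.
split.
  apply: tcover_subr (tcoverB xl yl) => _ [z Lz <-].
  by exists (mul x z); [exists z|exists (mul y z); [exists z|rewrite mulBl]].
apply: tcover_subr (tcoverB xr yr) => _ [z Lz <-].
by exists (mul z x); [exists z|exists (mul z y); [exists z|rewrite mulBr]].
Qed.

Lemma multiplierM x y : multiplier x -> multiplier y -> multiplier (mul x y).
Proof.
move=> [xl xr] [yl yr]; split.
  apply: tcover_subr (tcover_trans xl (tcover_image (mulxD x) yl)).
  by move=> _ [z Lz <-]; exists (mul y z); [exists z|rewrite mulA].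
apply: tcover_subr (tcover_trans yr (tcover_image (mulDx y) xr)).
by move=> _ [z Lz <-]; exists (mul z x); [exists z|rewrite mulA].
Qed.

Lemma sub_multiplier : L `<=` multiplier.
Proof.
move=> x Lx; split; apply: tcover_subr LM => _ [y Ly <-].
  by exists x => //; exists y.
by exists y => //; exists x.
Qed.

(** Choose multipliers as centres and expand [(a + l) (b + l')]: the [a b] form a finite set, [a l']
    and [l b] lie in finitely many multiples of [L], and [LM] covers [l l']. *)
Lemma tcover_mul Y Z : Y `<=` multiplier -> Z `<=` multiplier ->
  tcover L Y -> tcover L Z -> tcover L [set mul y z | y in Y & z in Z].
Proof.
move=> YX ZX cY cZ.
have [s sX sP] := tcover_in multiplier_group sub_multiplier YX cY.
have [t tX tP] := tcover_in multiplier_group sub_multiplier ZX cZ.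
have c1 := tcover_seq [seq mul a b | a <- s, b <- t] L0.
have c2 : tcover L [set y | exists2 a, a \in s & [set mul a z | z in L] y].
  by apply: tcover_bigU => a /sX[].
have c3 : tcover L [set y | exists2 b, b \in t & [set mul z b | z in L] y].
  by apply: tcover_bigU => a /tX[].
apply: tcover_subr (tcoverD (tcoverD c1 c2) (tcoverD c3 LM)).
move=> _ [y /sP[a as_ La] [z /tP[b bt Lb] <-]].
exists (mul a b + mul a (z - b)).
  exists (mul a b); first by rewrite /=; exact: allpairs_f.
  by exists (mul a (z - b)) => //; exists a => //; exists (z - b).
exists (mul (y - a) b + mul (y - a) (z - b)).
  exists (mul (y - a) b); first by exists b => //; exists (y - a).
  by exists (mul (y - a) (z - b)) => //; exists (y - a) => //; exists (z - b).
by rewrite -!mulDr ![b + _]addrC !subrK -mulDl addrC subrK.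
Qed.

(** All fibers of positive radius are commensurable with [L], but [L] need not lie in [G], which
    leaves room to change [G]. *)
Definition linear_model k G (f : A -> 'rV[R]_k) :=
  [/\ additive_subgroup G, G `<=` multiplier, additive_on G f,
      forall r, 0 < r -> tcover (fiber G f r) L &
      forall r, tcover L (fiber G f r)].

Lemma linear_model_exists : exists k G (f : A -> 'rV[R]_k), linear_model G f.
Proof.
have [k [G [f [gG [LG GX] fD [C LC] cf]]]] :=
  @additive_model R A L multiplier L0 LN LD multiplier_group sub_multiplier.
exists k, G, f; split=> // r r0.
by apply: tcover_subl (tcover_fiber gG fD LC r0) => x [a [b []]].
Qed.

Lemma minimal_linear_model : exists k G (f : A -> 'rV[R]_k), linear_model G f /\
  forall k' G' (f' : A -> 'rV[R]_k'), linear_model G' f' -> (k <= k')%N.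
Proof.
pose P k := `[< exists G (f : A -> 'rV[R]_k), linear_model G f >].
have exP : exists k, P k.
  have [k [G [f Gf]]] := linear_model_exists.
  by exists k; apply/asboolP; exists G, f.
case: (ex_minnP exP) => k /asboolP[G [f Gf]] min_k; exists k, G, f; split => //.
by move=> k' G' f' Gf'; apply: min_k; apply/asboolP; exists G', f'.
Qed.

(** * Linear models of minimal dimension *)

Section Minimal.
Variable k : nat.
Hypothesis min_k :
  forall k' G' (f' : A -> 'rV[R]_k'), linear_model G' f' -> (k <= k')%N.

Section Model.
Variables (G : set A) (f : A -> 'rV[R]_k).
Hypothesis Gf : linear_model G f.

Let gG : additive_subgroup G. Proof. by case: Gf. Qed.
Let GX : G `<=` multiplier. Proof. by case: Gf. Qed.
Let fD : additive_on G f. Proof. by case: Gf. Qed.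
Let fiberL r : 0 < r -> tcover (fiber G f r) L.
Proof. by case: Gf => _ _ _ + _; exact. Qed.
Let Lfiber r : tcover L (fiber G f r). Proof. by case: Gf. Qed.

Lemma fiberS r r' : r <= r' -> fiber G f r `<=` fiber G f r'.
Proof. by move=> rr' x [Gx /le_trans fx]; split => //; exact: fx. Qed.

Lemma fiberB r r' x y : fiber G f r x -> fiber G f r' y -> fiber G f (r + r') (x - y).
Proof.
move=> [Gx fx] [Gy fy]; split; first exact: subgroupB.
rewrite (additive_onB gG fD)//; apply: le_trans (ler_normB _ _) _; exact: lerD.
Qed.

Lemma fiber0 r : 0 <= r -> fiber G f r 0.
Proof.
by move=> r0; split; [exact: subgroup0|rewrite (additive_on0 gG fD) normr0].
Qed.

(* If the values of [f] on [fiber G f e] were killed by a nonzero functional,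
   dropping one coordinate on the subgroup generated by that fiber would
   contradict the minimality of [k]. *)
Lemma fiber_basis e : 0 < e -> exists (d : 'I_k -> A) (E : 'M[R]_k),
  [/\ E \in unitmx, forall i, fiber G f e (d i) & forall i, f (d i) = row i E].
Proof.
move=> e0; have [m [E [Efree EP Emax]]] := maximal_free_rows (f @` fiber G f e).
have mk : (m <= k)%N by rewrite -(eqP Efree) rank_leq_col.
move: mk; rewrite leq_eqVlt => /predU1P[mk|mk].
  subst m; have /choice[d dP] i : exists x, fiber G f e x /\ f x = row i E.
    by have [x ex fx] := EP i; exists x.
  exists d, E; split => [|i|i]; first by rewrite -row_free_unit.
    exact: (dP i).1.
  exact: (dP i).2.
have [u u0 Eu] := not_row_full_kernel E mk.
case: k f fD fiberL Lfiber min_k E mk u u0 Eu Efree EP Emax => // k'.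
move=> f' f'D cL cF mink E mk u u0 Eu Efree EP Emax.
have {}Emax x : fiber G f' e x -> f' x *m u = 0.
  move=> ex; have /submxP[a ->] := Emax (f' x) (ex_intro2 _ _ x ex erefl).
  by rewrite -mulmxA Eu mulmx0.
have /matrix0Pn[i0 [j0 ui0]] := u0; rewrite (ord1 j0) in ui0.
pose G' := generated_subgroup (fiber G f' e).
have G'G : G' `<=` G by apply: generated_sub => // x [].
have fu x : G' x -> f' x *m u = 0.
  suff : G' `<=` [set x | G x /\ f' x *m u = 0] by move=> h /h[].
  apply: generated_sub => [|y ey]; last by split; [case: ey|exact: Emax].
  split; first by split; [exact: subgroup0|rewrite (additive_on0 gG f'D) mul0mx].
  move=> y z [Gy fy] [Gz fz]; split; first exact: subgroupB.
  by rewrite (additive_onB gG f'D)// mulmxBl fy fz subrr.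
pose g x : 'rV[R]_k' := col' i0 (f' x).
suff /mink : linear_model G' g by rewrite ltnn.
split.
- exact: generated_subgroup_group.
- by move=> x /G'G /GX.
- by move=> x y /G'G Gx /G'G Gy; rewrite /g f'D//; apply/rowP => i; rewrite !mxE.
- move=> r r0; have m0 : 0 < Num.min e r by rewrite lt_min e0.
  apply: tcover_subl (cL _ m0) => x [Gx]; rewrite le_min => /andP[fe fr]; split.
    exact: sub_generated.
  apply: norm_le_coord => [|i]; first exact: ltW.
  by rewrite mxE; apply: le_trans (norm_coord _ _) fr.
(* The relation [f' x *m u = 0] with [u i0 0 != 0] recovers the dropped coordinate, at the cost of a
   factor [c]. *)
- move=> r; pose c := \sum_j `|u j 0| / `|u i0 0|.
  have c0 : 0 <= c by apply: sumr_ge0 => j _; rewrite divr_ge0.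
  apply: tcover_subr (cF (r + c * r)) => x [G'x gx]; split; first exact: G'G.
  have r0 : 0 <= r by apply: le_trans gx.
  have fj j : j != i0 -> `|f' x 0 j| <= r.
    move=> ji; case: (unliftP i0 j) => [j' jE|jE]; last by rewrite jE eqxx in ji.
    by apply: le_trans gx; have := norm_coord (g x) j'; rewrite mxE -jE.
  apply: norm_le_coord => [|j]; first by rewrite addr_ge0// mulr_ge0.
  have [->|ji] := eqVneq j i0; last by rewrite (le_trans (fj j ji))// lerDl mulr_ge0.
  apply: (@le_trans _ _ (c * r)); last by rewrite lerDr.
  have /matrixP/(_ 0 0) := fu x G'x; rewrite !mxE (bigD1 i0)//= => /eqP.
  rewrite addr_eq0 => /eqP fui.
  have -> : f' x 0 i0 = - (\sum_(i < k'.+1 | i != i0) f' x 0 i * u i 0) / u i0 0.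
    by rewrite -fui mulfK.
  rewrite normrM normrN normfV ler_pdivrMr ?normr_gt0//.
  apply: le_trans (ler_norm_sum _ _ _) _.
  rewrite /c -mulr_suml mulrAC divfK ?normr_eq0// mulr_suml.
  rewrite [leRHS](bigD1 i0)//=; apply: ler_wpDl; first by rewrite mulr_ge0.
  by apply: ler_sum => i ii; rewrite normrM mulrC ler_wpM2l// fj.
Qed.

(** By [integral_part], an element is a remainder of small value plus an integral combination of
    basis elements from a smaller fiber. *)
Lemma fiber_generates e Y : 0 < e -> additive_subgroup Y ->
  fiber G f e `<=` Y -> G `<=` Y.
Proof.
(* The remainder has norm at most [k] times [e']; the divisor [k.+1] also allows [k = 0]. *)
move=> e0 gY fY x Gx; pose e' := e / k.+1%:R.
have e'0 : 0 < e' by rewrite divr_gt0.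
have [d [E [Eu dP dE]]] := fiber_basis e'0.
have [z [m [Gz fz -> _]]] := integral_part gG fD Eu (fun i => (dP i).1) dE Gx.
apply: subgroupD => //.
  apply: fY; split => //; apply: le_trans fz _.
  apply: (@le_trans _ _ (\sum_(i < k) e')).
    by apply: ler_sum => i _; case: (dP i).
  rewrite sumr_const card_ord -mulr_natr /e' mulrAC ler_pdivrMr//.
  by rewrite ler_pM2l// ler_nat.
apply: subgroup_sum => // i; apply: subgroupMz => //; apply: fY.
apply: fiberS (dP i); rewrite /e' ler_pdivrMr// ler_peMr ?ler1n//; exact: ltW.
Qed.

(* Shrink the fiber until [s] is minimal; then every element of [s] is attained
   arbitrarily close to [0], so [s] is closed under subtraction modulo [T]. *)
Lemma finite_image (h : A -> A) T s : additive_on G h -> additive_subgroup T ->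
  (forall y, fiber G f 1 y -> exists2 a, a \in s & T (h y - a)) ->
  forall y, G y -> exists2 a, a \in s & T (h y - a).
Proof.
move=> hD gT' hs.
pose P n := `[< exists (t : seq A) (e : R), [/\ {subset t <= s}, size t = n, 0 < e &
  forall y, fiber G f e y -> exists2 a, a \in t & T (h y - a)] >].
have exP : exists n, P n by exists (size s); apply/asboolP; exists s, 1; split.
case: (ex_minnP exP) => n /asboolP[t [e [ts tn e0 te]]] min_n.
(* Otherwise [a] could be removed from [t] at radius [Num.min e e']. *)
have small a e' : a \in t -> 0 < e' -> exists2 p, fiber G f e' p & T (h p - a).
  move=> at_ e'0; apply: contrapT => np.
  have m0 : 0 < Num.min e e' by rewrite lt_min e0.
  have /min_n : P (size ([seq b <- t | predC1 a b])).
    apply/asboolP; exists ([seq b <- t | predC1 a b]), (Num.min e e'); split => //.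
      by move=> b; rewrite mem_filter => /andP[_ /ts].
    move=> y ey; have [|b bt Tb] := te y.
      by apply: fiberS ey; rewrite ge_min lexx.
    exists b => //; rewrite mem_filter bt andbT; apply/eqP => ba.
    apply: np; exists y; last by rewrite -ba.
    by apply: fiberS ey; rewrite ge_min lexx orbT.
  rewrite size_filter -tn leqNgt => /negP; apply.
  rewrite -(count_predC (pred1 a) t) -[X in (X < _)%N]add0n ltn_add2r.
  by rewrite -has_count has_pred1.
suff h' : G `<=` [set y | G y /\ exists2 a, a \in t & T (h y - a)].
  by move=> y /h'[_ [a /ts]]; exists a.
apply: (fiber_generates e0) => [|y ey]; last by split; [case: ey|exact: te].
have e20 : 0 < e / 2 by rewrite divr_gt0.
split.
  by split; [exact: subgroup0|apply: te; apply/fiber0/ltW].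
move=> y z [Gy [a at_ Ta]] [Gz [b bt Tb]]; split; first exact: subgroupB.
(* Modulo [T], [h (y - z)] is [a - b], hence [h (p - p')], and [p - p'] is in the fiber of radius
   [e]. *)
have [p ep Tp] := small a _ at_ e20; have [p' ep' Tp'] := small b _ bt e20.
have := fiberB ep ep'; rewrite -splitr => epp.
have [c ct Tc] := te _ epp; exists c => //.
have -> : h (y - z) - c =
    ((h y - a) - (h p - a)) - ((h z - b) - (h p' - b)) + (h (p - p') - c).
  rewrite !(additive_onB gG hD)//; [|by case: ep|by case: ep'].
  by rewrite !(subrBB _ a) !(subrBB _ b) !subrr !subr0 (subrBB (h y)) subrKA.
by apply: subgroupD => //; apply: subgroupB => //; apply: subgroupB.
Qed.

(** [mul a] maps the unit fiber into finitely many translates of it, hence to finitely many classes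
    modulo [G]; [finite_image] extends this to [G]. *)
Lemma multiplier_finite_mod a : multiplier a ->
  exists s, forall y, G y -> exists2 b, b \in s & G (mul a y - b).
Proof.
move=> [aL _]; have : tcover (fiber G f 1) [set mul a y | y in fiber G f 1].
  apply: tcover_trans (fiberL ltr01) _; apply: tcover_trans aL _.
  exact: tcover_image.
move=> [s sP]; exists s; apply: finite_image => // y ey.
by have [|b bs []] := sP (mul a y); [exists y|exists b].
Qed.

(** One pigeonhole on the class of [mul a y] modulo [G] for each [a]; halving the radius absorbs the
    differences. *)
Lemma tcover_stabilizer t : {in t, forall a, multiplier a} -> forall r, 0 < r ->
  tcover [set y | fiber G f r y /\ {in t, forall a, G (mul a y)}] L.
Proof.
elim: t => [|a t IHt] tX r r0.
  by apply: tcover_subl (fiberL r0) => y ry; split.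
have r20 : 0 < r / 2 by rewrite divr_gt0.
apply: tcover_trans (IHt _ (r / 2) r20); last first.
  by move=> b bt; apply: tX; rewrite inE bt orbT.
have [s sP] := multiplier_finite_mod (tX a (mem_head _ _)).
apply: (@tcover_colour _ _ (fun y b => G (mul a y - b)) s).
  by move=> y [[Gy _] _]; exact: sP.
move=> x y b [xr xt] [yr yt] Gx Gy; split.
  by rewrite [r]splitr; exact: fiberB.
move=> c; rewrite inE mulBr => /predU1P[->|ct].
  by have := subgroupB gG Gy Gx; rewrite subrBB subrr subr0.
by apply: subgroupB => //; [exact: yt|exact: xt].
Qed.

(** For fixed [x], the classes of [mul x y] modulo [G] form a finite group. The list [s] comes from
    covering all products of the unit fiber with itself, so a single [N] serves every [x]. *)
Lemma product_torsion : exists s N, [/\ (0 < N)%N,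
  {in s, forall a, multiplier a /\ G (a *+ N)} &
  forall x y, fiber G f 1 x -> G y -> exists2 a, a \in s & G (mul x y - a)].
Proof.
have fX : fiber G f 1 `<=` multiplier by move=> x [/GX].
have PPX : [set mul x y | x in fiber G f 1 & y in fiber G f 1] `<=` multiplier.
  by move=> _ [x /fX Xx [y /fX Xy <-]]; exact: multiplierM.
have cPP := tcover_mul fX fX (Lfiber 1) (Lfiber 1).
have [s sX sP] := tcover_in multiplier_group fX PPX
  (tcover_trans (fiberL ltr01) cPP).
have sG x : fiber G f 1 x -> forall y, G y ->
    exists2 a, a \in s & G (mul x y - a).
  move=> x1; apply: finite_image => // z z1.
  have [|b bs []] := sP (mul x z); last by exists b.
  by exists x => //; exists z.
(* Only elements congruent to an actual product are kept; these are torsion modulo [G]. *)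
exists [seq a <- s |
  `[< exists x y, [/\ fiber G f 1 x, G y & G (mul x y - a)] >]].
exists (size s)`!; split.
- exact: fact_gt0.
- move=> a; rewrite mem_filter => /andP[/asboolP[x [y [x1 Gy Gxya]]] as_].
  split; first exact: sX.
  have /choice[b bP] j : exists b, b \in s /\ G (mul x y *+ j - b).
    have [|b bs Gb] := sG x x1 (y *+ j); first exact: subgroupMn.
    by exists b; rewrite -mulMnr.
  have lt_index j : (index (b j) s < size s)%N.
    by rewrite index_mem; case: (bP j).
  (* Two of the first [(size s).+1] multiples of [mul x y] agree modulo [G]; the difference of their
     indices divides the factorial. *)
  pose c (j : 'I_(size s).+1) : 'I_(size s) := Ordinal (lt_index j).
  have : ~~ injectiveb c.
    by apply/injectiveP => /leq_card; rewrite !card_ord ltnn.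
  move=> /injectivePn[i [j ij cij]].
  have bij : b i = b j.
    have /(congr1 val)/= e := cij.
    by rewrite -(nth_index a (bP i).1) e nth_index ?(bP j).1.
  wlog ltij : i j ij bij {cij} / (i < j)%N.
    move=> H; have : (i != j :> nat) by [].
    rewrite neq_ltn => /orP[lt|lt]; first exact: (H i j).
    by apply: (H j i) => //; rewrite eq_sym.
  have Gxy : G (mul x y *+ (j - i)).
    rewrite mulrnBr; last exact: ltnW.
    have := subgroupB gG (bP j).2 (bP i).2.
    by rewrite bij subrBB subrr subr0.
  have -> : a *+ (size s)`! = mul x y *+ (size s)`! - (mul x y - a) *+ (size s)`!.
    by rewrite mulrnBl opprB addrC subrK.
  apply: subgroupB => //; last exact: subgroupMn.
  have /dvdnP[q ->] : (j - i %| (size s)`!)%N.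
    apply: dvdn_fact; rewrite subn_gt0 ltij /= leq_subLR.
    by rewrite (leq_trans (leq_ord j))// leq_addl.
  by rewrite mulnC mulrnA; exact: subgroupMn.
- move=> x y x1 Gy; have [a as_ Ga] := sG x x1 y Gy; exists a => //.
  by rewrite mem_filter as_ andbT; apply/asboolP; exists x, y.
Qed.

(* The products of elements of [G] generate a finite extension [G'] of [G], and
   the largest subset of [G'] multiplying [G'] into itself is a subring, of
   finite index in [G']. *)
Lemma subring_model : exists D (f' : A -> 'rV[R]_k),
  linear_model D f' /\ forall x y, D x -> D y -> D (mul x y).
Proof.
have [s [n [n0 sn sP]]] := product_torsion.
have [|G' [gG' GG' sG' cG' [[N [N0 NG']] G'X]]] :=
  torsion_extension n0 gG (s := s).
  by move=> a /sn[].
have {}G'X : G' `<=` multiplier.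
  by apply: G'X => //; [exact: multiplier_group|move=> a /sn[]].
(* For the left factor the unit fiber suffices, as it generates [G]. *)
have GGG' x y : G x -> G y -> G' (mul x y).
  move=> Gx Gy; suff /(_ x Gx) : G `<=` [set x | G' (mul x y)] by [].
  apply: (fiber_generates ltr01) => [|z z1].
    split=> [|u v Gu Gv]; first by rewrite /= mul0l; exact: subgroup0 gG'.
    by rewrite /= mulBl; exact: subgroupB.
  have [a as_ Ga] := sP z y z1 Gy; rewrite /= -(subrK a (mul z y)).
  by apply: subgroupD => //; [exact: GG'|exact: sG'].
have [t tG' tP] := tcover_in gG' GG' (@subset_refl _ G') cG'.
pose D := [set y | G' y /\ forall z, G' z -> G' (mul z y)].
have gD : additive_subgroup D.
  split=> [|x y [G'x Dx] [G'y Dy]].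
    by split=> [|z _]; rewrite ?mul0r; exact: subgroup0 gG'.
  split=> [|z G'z]; first exact: subgroupB.
  by rewrite mulBr; apply: subgroupB => //; [exact: Dx|exact: Dy].
(* As [t] represents [G'] modulo [G], finitely many conditions suffice, and [tcover_stabilizer]
   applies. *)
have GD y : G y -> {in t, forall a, G (mul a y)} -> D y.
  move=> Gy ty; split=> [|z G'z]; first exact: GG'.
  have [a at_ Gza] := tP z G'z; rewrite -(subrK a z) mulDl; apply: subgroupD => //.
    exact: GGG'.
  by apply/GG'/ty.
(* [x *+ N] is in [G] for [x] in [G'], so this extends [f]. *)
pose f' x := N%:R^-1 *: f (x *+ N).
have NR : (N%:R : R) != 0 by rewrite pnatr_eq0 -lt0n.
have f'D : additive_on G' f'.
  by move=> x y G'x G'y; rewrite /f' mulrnDl fD ?scalerDr//; exact: NG'.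
have f'G x : G x -> f' x = f x.
  move=> Gx; rewrite /f' (additive_onMn gG fD)// -[f x *+ N]scaler_nat.
  by rewrite scalerA mulVf// scale1r.
exists D, f'; split; last first.
  move=> x y [G'x Dx] [G'y Dy]; split=> [|z G'z]; first exact: Dy.
  by rewrite mulA; apply/Dy/Dx.
split => //.
- by move=> x [/G'X].
- by move=> x y [G'x _] [G'y _]; exact: f'D.
- move=> r r0.
  apply: tcover_subl (tcover_stabilizer _ r0) => [y [[Gy fy] ty]|a /tG'/G'X //].
  by split; [exact: GD|rewrite f'G].
- move=> r; pose rho := r + \sum_(a <- t) `|f' a|.
  apply: tcover_trans (Lfiber rho) _; exists t => z [[G'z _] fz].
  have [a at_ Gza] := tP z G'z; exists a => //; split => //.
  have G'a := tG' a at_.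
  rewrite -f'G// (additive_onB gG' f'D)//; apply: le_trans (ler_normB _ _) _.
  apply: lerD => //; rewrite (big_rem a)//= lerDl; exact: sumr_ge0.
Qed.

(** Translates of the unit fiber with finitely many centres in [G] cover [Y]. *)
Lemma tcover_bounded Y : Y `<=` G -> tcover L Y ->
  exists C, forall y, Y y -> `|f y| <= C.
Proof.
move=> YG cY; have fG : fiber G f 1 `<=` G by move=> x [].
have [s sG sP] := tcover_in gG fG YG (tcover_trans (fiberL ltr01) cY).
exists (1 + \sum_(a <- s) `|f a|) => y Yy; have [a as_ [Gya fya]] := sP y Yy.
have Ga := sG a as_; rewrite -(subrK a y) fD//.
apply: le_trans (ler_normD _ _) _; apply: lerD => //.
by rewrite (big_rem a)//= lerDl; exact: sumr_ge0.
Qed.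

(** With one factor fixed, [f (mul x y)] is additive and bounded on fibers, because [L] covers the
    product of a fiber and a point. Hence [bounded_additive_linear] applies to each argument in
    turn. *)
Lemma real_algebra_of_model : (forall x y, G x -> G y -> G (mul x y)) ->
  exists mulB : 'rV[R]_k -> 'rV[R]_k -> 'rV[R]_k, real_algebra_mult mulB /\
    forall x y, G x -> G y -> f (mul x y) = mulB (f x) (f y).
Proof.
move=> GM; have [d [E [Eu dG dE]]] := fiber_basis ltr01.
have Gd i : G (d i) by case: (dG i).
have bounded y r : G y -> exists C,
    (forall x, G x -> `|f x| <= r -> `|f (mul x y)| <= C) /\
    forall x, G x -> `|f x| <= r -> `|f (mul y x)| <= C.
  move=> Gy; have cy : tcover L [set y].
    by exists [:: y] => _ ->; exists y; rewrite ?mem_head// subrr.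
  have yX : [set y] `<=` multiplier by move=> _ ->; exact: GX.
  have fX : fiber G f r `<=` multiplier by move=> x [/GX].
  have [|C CP] := tcover_bounded _ (tcover_mul fX yX (Lfiber r) cy).
    by move=> _ [x [Gx _] [_ -> <-]]; exact: GM.
  have [|C' CP'] := tcover_bounded _ (tcover_mul yX fX cy (Lfiber r)).
    by move=> _ [_ -> [x [Gx _] <-]]; exact: GM.
  exists (Num.max C C'); split=> x Gx fx; rewrite le_max.
    by rewrite CP//; exists x => //; exists y.
  by rewrite CP' ?orbT//; exists y => //; exists x.
pose co (v : 'rV[R]_k) i := (v *m invmx E) 0 i.
pose mulB u v := \sum_i co u i *: \sum_j co v j *: f (mul (d i) (d j)).
have coD u v i : co (u + v) i = co u i + co v i by rewrite /co mulmxDl mxE.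
have coZ a u i : co (a *: u) i = a * co u i by rewrite /co -scalemxAl mxE.
have mulBDl u v w : mulB (u + v) w = mulB u w + mulB v w.
  by rewrite -big_split; apply: eq_bigr => i _; rewrite coD scalerDl.
have mulBDr w u v : mulB w (u + v) = mulB w u + mulB w v.
  rewrite -big_split; apply: eq_bigr => i _ /=; rewrite -scalerDr; congr (_ *: _).
  by rewrite -big_split; apply: eq_bigr => j _; rewrite coD scalerDl.
have mulBZl a u v : mulB (a *: u) v = a *: mulB u v.
  by rewrite scaler_sumr; apply: eq_bigr => i _; rewrite coZ scalerA.
have mulBZr a u v : mulB u (a *: v) = a *: mulB u v.
  rewrite scaler_sumr; apply: eq_bigr => i _.
  rewrite scalerA mulrC -scalerA; congr (_ *: _).
  by rewrite scaler_sumr; apply: eq_bigr => j _; rewrite coZ scalerA.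
have fM x y : G x -> G y -> f (mul x y) = mulB (f x) (f y).
  move=> Gx Gy.
  have -> := @bounded_additive_linear R A G gG k f fD d E Eu Gd dE k
    (fun x => f (mul x y)) _ _ x Gx.
  - apply: eq_bigr => i _; congr (_ *: _).
    apply: (@bounded_additive_linear R A G gG k f fD d E Eu Gd dE k
      (fun y => f (mul (d i) y))) => //.
      by move=> u v Gu Gv; rewrite mulDr fD//; exact: GM.
    by move=> r; have [C [_ CP]] := bounded (d i) r (Gd i); exists C.
  - by move=> u v Gu Gv; rewrite mulDl fD//; exact: GM.
  - by move=> r; have [C [CP _]] := bounded y r Gy; exists C.
(* Used to reduce associativity to basis vectors, one argument at a time; there it is inherited from
   [mul]. *)
have ext (h h' : 'rV[R]_k -> 'rV[R]_k) :
    (forall u v, h (u + v) = h u + h v) -> (forall a u, h (a *: u) = a *: h u) ->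
    (forall u v, h' (u + v) = h' u + h' v) ->
    (forall a u, h' (a *: u) = a *: h' u) ->
    (forall i, h (f (d i)) = h' (f (d i))) -> h =1 h'.
  move=> hD hZ h'D h'Z hh' u.
  have -> : u = \sum_i co u i *: f (d i).
    rewrite -[LHS](mulmxKV Eu) mulmx_sum_row.
    by apply: eq_bigr => i _; rewrite dE.
  elim/big_ind: _ => [|v w hv hw|i _].
  - by rewrite -(scale0r (0 : 'rV[R]_k)) hZ h'Z !scale0r.
  - by rewrite hD h'D hv hw.
  - by rewrite hZ h'Z hh'.
have mulBA3 i j w :
    mulB (f (d i)) (mulB (f (d j)) w) = mulB (mulB (f (d i)) (f (d j))) w.
  move: w; apply: ext.
  - by move=> u v; rewrite !mulBDr.
  - by move=> a u; rewrite !mulBZr.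
  - by move=> u v; rewrite mulBDr.
  - by move=> a u; rewrite mulBZr.
  - by move=> l; rewrite -!fM ?mulA//; exact: GM.
have mulBA2 i v w : mulB (f (d i)) (mulB v w) = mulB (mulB (f (d i)) v) w.
  move: v; apply: (ext (fun v => mulB _ (mulB v w)) (fun v => mulB (mulB _ v) w)).
  - by move=> u v; rewrite mulBDl mulBDr.
  - by move=> a u; rewrite mulBZl mulBZr.
  - by move=> u v; rewrite mulBDr mulBDl.
  - by move=> a u; rewrite mulBZr mulBZl.
  - by move=> j; exact: mulBA3.
suff mulBA : associative mulB by exists mulB.
move=> u v w; move: u.
apply: (ext (fun u => mulB u (mulB v w)) (fun u => mulB (mulB u v) w)).
- by move=> u u'; rewrite mulBDl.
- by move=> a u; rewrite mulBZl.
- by move=> u u'; rewrite !mulBDl.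
- by move=> a u; rewrite !mulBZl.
- by move=> i; exact: mulBA2.
Qed.

End Model.
End Minimal.

Lemma subring_model_exists : exists k D (f : A -> 'rV[R]_k) mulB,
  [/\ linear_model D f, forall x y, D x -> D y -> D (mul x y),
      real_algebra_mult mulB &
      forall x y, D x -> D y -> f (mul x y) = mulB (f x) (f y)].
Proof.
have [k [G [f [Gf min_k]]]] := minimal_linear_model.
have [D [f' [Df' DM]]] := subring_model min_k Gf.
have [mulB [algB f'M]] := real_algebra_of_model min_k Df' DM.
by exists k, D, f', mulB.
Qed.

End ApproximateRing.

(** * Topology *)

Section RealAlgebraTopology.
Variables (R : realType) (n : nat).

Lemma compact_closed_ball_rV (x : 'rV[R]_n) r :
  compact [set v : 'rV[R]_n | `|v - x| <= r] /\
  closed [set v : 'rV[R]_n | `|v - x| <= r].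
Proof.
have cl : closed [set v : 'rV[R]_n | `|v - x| <= r].
  apply: ((continuous_closedP (fun v : 'rV[R]_n => `|v - x|)).1 _ _ (@closed_le R r)).
  move=> v; apply: (@cvg_norm R 'rV[R]_n _ (nbhs v)).
  by apply: (@cvgB R 'rV[R]_n _ (nbhs v)); [exact: cvg_id|exact: cvg_cst].
split=> //; apply: bounded_closed_compact => //.
exists (r + `|x|); split; first exact: num_real.
move=> M rM v /= vx; rewrite -(subrK x v).
by apply: le_trans (ler_normD _ _) _; apply: le_trans (ltW rM); exact: lerD.
Qed.

Lemma continuous_sum (T : topologicalType) (I : Type) (r : seq I)
    (F : I -> T -> 'rV[R]_n) :
  (forall i, continuous (F i)) -> continuous (fun x => \sum_(i <- r) F i x).
Proof.
move=> cF; elim: r => [|i r IHr].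
  have -> : (fun x => \sum_(i <- [::]) F i x) = cst 0.
    by apply/funext => x; rewrite big_nil.
  exact: cst_continuous.
have -> : (fun x => \sum_(j <- i :: r) F j x) =
    F i \+ (fun x => \sum_(j <- r) F j x).
  by apply/funext => x; rewrite big_cons.
by move=> x; apply: continuousD; [exact: cF|exact: IHr].
Qed.

Lemma nbhs_closed_ball_rV (x : 'rV[R]_n) r : 0 < r ->
  nbhs x [set v : 'rV[R]_n | `|v - x| <= r].
Proof.
move=> r0; apply/nbhs_ballP; exists r => // v.
by rewrite mx_norm_ball /ball_/= distrC => /ltW.
Qed.

Lemma real_algebra_locally_compact (mulB : 'rV[R]_n -> 'rV[R]_n -> 'rV[R]_n) :
  real_algebra_mult mulB -> locally_compact_ring mulB.
Proof.
move=> [rB Zl Zr]; split => //; last first.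
  move=> x _; have [cB clB] := compact_closed_ball_rV x 1.
  exists [set v | `|v - x| <= 1] => //.
  by apply: filterS (nbhs_closed_ball_rV x ltr01) => v.
have [_ Dl Dr] := rB.
have suml (I : Type) (r : seq I) (F : I -> 'rV[R]_n) w :
    mulB (\sum_(i <- r) F i) w = \sum_(i <- r) mulB (F i) w.
  elim: r => [|i r IHr]; last by rewrite !big_cons Dl IHr.
  by have := Zl 0 0 w; rewrite !big_nil !scale0r.
have sumr (I : Type) (r : seq I) (F : I -> 'rV[R]_n) w :
    mulB w (\sum_(i <- r) F i) = \sum_(i <- r) mulB w (F i).
  elim: r => [|i r IHr]; last by rewrite !big_cons Dr IHr.
  by have := Zr 0 w 0; rewrite !big_nil !scale0r.
have -> : (fun x : 'rV[R]_n * 'rV[R]_n => mulB x.1 x.2) = fun x =>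
    \sum_i \sum_j (x.1 0 i * x.2 0 j) *: mulB (delta_mx 0 i) (delta_mx 0 j).
  apply/funext => x; rewrite {1}(row_sum_delta x.1) suml; apply: eq_bigr => i _.
  rewrite {1}(row_sum_delta x.2) sumr; apply: eq_bigr => j _.
  by rewrite Zl Zr scalerA.
apply: continuous_sum => i; apply: continuous_sum => j x.
apply: (@cvgZr_tmp R 'rV[R]_n _ (nbhs x)); apply: (@cvgM R _ (nbhs x)).
  apply: (@continuous_comp _ _ _ fst (fun v : 'rV[R]_n => v 0 i) x).
    exact: cvg_fst.
  exact: (@coord_continuous R 1 n 0 i).
apply: (@continuous_comp _ _ _ snd (fun v : 'rV[R]_n => v 0 j) x).
  exact: cvg_snd.
exact: (@coord_continuous R 1 n 0 j).
Qed.

End RealAlgebraTopology.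

(** * Discreteness of sets covered by a uniformly discrete set *)

Section Discreteness.
Variables (A : topologicalZmodType) (L Y : set A).

Lemma nbhs_translate (d : A) (U : set A) : nbhs 0 U -> nbhs d [set a | U (a - d)].
Proof.
move=> U0; have : (fun a : A => a - d) @ d --> d - d.
  apply: (@cvg_comp _ _ _ (fun a : A => (a, - d)) (fun x => x.1 + x.2) _
    (nbhs (d, - d))).
    by apply: cvg_pair; [exact: cvg_id|exact: cvg_cst].
  exact: (add_continuous (d, - d)).
by rewrite subrr; apply.
Qed.

(* A translate [a + L] meets [- W] in at most one point. *)
Lemma uniformly_discrete_isolated0 : hausdorff_space A ->
  uniformly_discrete L -> tcover L Y ->
  exists2 U : set A, nbhs 0 U & forall y, Y y -> U y -> y = 0.
Proof.
move=> hA [W W0 WL] [s sP].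
pose Z := [set y | [/\ Y y, W (- y) & y != 0]].
have [|r rZ rP] := @colour_representatives _ _ (fun y a => L (y - a)) s Z.
  by move=> y [/sP].
(* If [y] and its representative [a] share the colour [b], then [- b] lies in both [(y - b) + W] and
   [(a - b) + W], so [y = a]. Hence [Z] is finite and can be cut out of the neighbourhood. *)
have Zr y : Z y -> y \in r.
  move=> Zy; have [a ar [b Lab Lyb]] := rP y Zy.
  have [_ Wa _] := rZ a ar; have [_ Wy _] := Zy.
  suff /addIr -> : y - b = a - b by [].
  apply: contrapT => ne; have := WL _ _ Lyb Lab ne.
  apply/eqP/set0P; exists (- b); split.
    by exists (- y) => //; rewrite addrC addKr.
  by exists (- a) => //; rewrite addrC addKr.
have WN : nbhs 0 [set x : A | W (- x)].
  by have := @opp_continuous A 0; rewrite /continuous_at oppr0; apply.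
have rC : nbhs (0 : A) (~` [set` r]).
  apply: open_nbhs_nbhs; split; last first.
    by move=> /= /rZ[_ _]; rewrite eqxx.
  apply: closed_openC.
  apply: (accessible_finite_set_closed.1 (hausdorff_accessible hA)).
  exact: finite_seq.
exists ([set x | W (- x)] `&` ~` [set` r]); first exact: filterI.
move=> y Yy [/= Wy yr]; apply/eqP; apply: contra_notT yr => y0.
by apply: Zr.
Qed.

End Discreteness.

Theorem theorem1p9 (R : realType) (A : topologicalZmodType)
    (mulA : A -> A -> A) (hA : locally_compact_ring mulA)
    (L : set A) (happ : approximate_subring mulA L)
    (hud : uniformly_discrete L) :
  exists (n : nat) (mulB : 'rV[R]_n -> 'rV[R]_n -> 'rV[R]_n) (M : set A),
    [/\ real_algebra_mult mulB,
        weak_model_set mulA mulB M &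
        commensurable L M].
Proof.
have [rA _ hausA _] := hA; have [[L0 LN] /covered_by_translatesE cL] := happ.
have LN' x : L x -> L (- x) by move=> Lx; rewrite LN; exists x.
have [k [D [f [mulB [[gD _ fD fiberL Lfiber] DM algB fM]]]]] :=
  @subring_model_exists R A mulA L rA L0 LN' (tcover_subr (@subsetUr _ _ _) cL)
    (tcover_subr (@subsetUl _ _ _) cL).
(* With the closed unit ball as window, the graph of [f] yields the unit fiber as weak model set. *)
pose Delta : set (A * 'rV[R]_k) := [set x | D x.1 /\ x.2 = f x.1].
pose W0 : set 'rV[R]_k := [set v | `|v| <= 1].
have W0E : [set v : 'rV[R]_k | `|v - 0| <= 1] = W0.
  by apply/seteqP; split=> v; rewrite /W0 /= subr0.
exists k, mulB, (fst @` (Delta `&` ([set: A] `*` W0))); split => //; last first.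
  have -> : fst @` (Delta `&` ([set: A] `*` W0)) = fiber D f 1.
    apply/seteqP; split=> [_ [[x v] [[/= Dx ->] [_ fx]] <-]//|x [Dx fx]].
    by exists (x, f x).
  by split; apply/covered_by_translatesE; [exact: Lfiber|exact: fiberL].
exists Delta, W0; split => //.
- split => //.
  + exact: real_algebra_locally_compact.
  + split=> [|[x u] [y v] [/= Dx ->] [/= Dy ->]|[x u] [y v] [/= Dx ->] [/= Dy ->]].
    * by split; [exact: subgroup0 gD|rewrite /= (additive_on0 gD fD)].
    * by split; [exact: subgroupB|rewrite /= (additive_onB gD fD)].
    * by split; [exact: DM|rewrite /= fM].
  (* A point of the graph close to [(x, f x)] differs from it in the first coordinate by an element
     of the unit fiber lying in [U], that is, by 0. *)
  + move=> [x u] [/= Dx ->]; split; first by rewrite inE.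
    have [U U0 UD] := uniformly_discrete_isolated0 hausA hud (Lfiber 1).
    exists ([set a | U (a - x)] `*` [set v | `|v - f x| <= 1]).
      exists ([set a | U (a - x)], [set v | `|v - f x| <= 1]) => //=; split.
        exact: nbhs_translate.
      exact: nbhs_closed_ball_rV.
    apply/seteqP; split=> [[y v] [[/= Uy vy] [/= Dy vE]]|_ ->].
      rewrite vE in vy *; suff -> : y = x by [].
      apply/eqP; rewrite -subr_eq0; apply/eqP; apply: UD Uy; split.
        exact: subgroupB.
      by rewrite (additive_onB gD fD).
    by split; split => //=; rewrite ?subrr ?normr0//; exact: nbhs_singleton.
  + by move=> [x u] [y v]; rewrite !inE => -[/= _ ->] [/= _ ->] /= ->.
- have [] := compact_closed_ball_rV (0 : 'rV[R]_k) 1; rewrite W0E.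
  by move=> cW clW; rewrite precompact_closed.
- split; first by rewrite /W0/= normr0.
  apply/seteqP; split=> [v Wv|_ [v Wv <-]]; last by rewrite /W0/= normrN.
  by exists (- v); rewrite ?opprK// /W0/= normrN.
- by have := nbhs_closed_ball_rV (0 : 'rV[R]_k) ltr01; rewrite W0E.
Qed.
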